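(* Let $K$ be a field, $S=K[x_1,\ldots,x_n]$, and let $I\subset S$ be a monomial ideal with $\dim S/I=0$. Let $L(I)\subset S^\wp$ be the ideal generated by the monomials $x_{1,a_1+1}\cdots x_{n,a_n+1}$ with $x_1^{a_1}\cdots x_n^{a_n}\in\operatorname{Mon}(S\setminus I)$. For $i=1,\ldots,n$, let $b_i$ be the smallest integer such that $x_i^{b_i}\in I$. Then for all integers $k\ge 1$, $$\operatorname{depth} S^\wp/L(I)^k=\sum_{i=1}^n b_i-\max\{\deg(\operatorname{lcm}(u_1,\ldots,u_k)) : u_1,\ldots,u_k\in\operatorname{Mon}(S\setminus I)\}-1.$$ In particular, $\operatorname{depth} S^\wp/L(I)^k=n-1$ for all $k\geq n$, and $$\operatorname{depth} S^\wp/L(I)^k>\operatorname{depth} S^\wp/L(I)^{k+1}$$ as long as $\operatorname{depth} S^\wp/L(I)^k>n-1$.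
   Context: $\operatorname{Mon}(S\setminus I)$ is the (finite) set of monomials of $S$ not belonging to $I$. $S^\wp$ is the standard graded polynomial ring over $K$ in the variables $x_{i,j}$, $1\le i\le n$, $1\le j\le b_i$. Depth is taken with respect to the graded maximal ideal of $S^\wp$. The monomials $u_1,\ldots,u_k$ in the maximum are not required to be distinct. *)

(* Defs.v *)
(* Written over Mathematical Components and its multinomials library. *)
From mathcomp Require Import all_boot all_algebra.
From mathcomp.multinomials Require Import mpoly.

Set Implicit Arguments.
Unset Strict Implicit.
Unset Printing Implicit Defensive.

Import GRing.Theory.
Local Open Scope ring_scope.

Definition is_least (P : nat -> Prop) (m : nat) : Prop :=
  P m /\ forall m', P m' -> (m <= m')%N.

Definition is_greatest (P : nat -> Prop) (m : nat) : Prop :=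
  P m /\ forall m', P m' -> (m' <= m)%N.

(* Ideals are Prop-valued predicates, possibly equal to the whole ring: the    *)
(* [idealr_closed] of ring_quotient covers only decidable, proper ideals.      *)
Definition is_ideal (R : comNzRingType) (J : R -> Prop) : Prop :=
  [/\ J 0, forall p q, J p -> J q -> J (p + q) & forall a p, J p -> J (a * p)].

Definition ideal_gen (R : comNzRingType) (A : R -> Prop) : R -> Prop :=
  fun p => forall J, is_ideal J -> (forall q, A q -> J q) -> J p.

Definition ideal_mul (R : comNzRingType) (I J : R -> Prop) : R -> Prop :=
  ideal_gen (fun p => exists a b, [/\ I a, J b & p = a * b]).

Fixpoint ideal_pow (R : comNzRingType) (J : R -> Prop) (k : nat) : R -> Prop :=
  if k is k'.+1 then ideal_mul J (ideal_pow J k') else fun _ => True.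

Definition ideal_add_seq (R : comNzRingType) (J : R -> Prop) (s : seq R) :
    R -> Prop :=
  ideal_gen (fun p => J p \/ p \in s).

Definition is_prime_ideal (R : comNzRingType) (P : R -> Prop) : Prop :=
  [/\ is_ideal P, ~ P 1 & forall a b, P (a * b) -> P a \/ P b].

(* Chains P_0 < ... < P_d of prime ideals of R / J, seen as primes of R        *)
(* containing J; only the values of P at 0, ..., d matter.                     *)
Definition prime_chain_over (R : comNzRingType) (J : R -> Prop) (d : nat)
    (P : nat -> R -> Prop) : Prop :=
  (forall i, (i <= d)%N ->
     is_prime_ideal (P i) /\ (forall p, J p -> P i p)) /\
  (forall i, (i < d)%N ->
     (forall p, P i p -> P i.+1 p) /\ (exists p, P i.+1 p /\ ~ P i p)).

(* dim R/J = d; it holds for no d when J is the whole ring. *)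
Definition has_quot_dim (R : comNzRingType) (J : R -> Prop) (d : nat) : Prop :=
  is_greatest (fun l => exists P, prime_chain_over J l P) d.

(* s = f_1, ..., f_r is a regular sequence on the R-module M = R/J: f_(i+1) is *)
(* a nonzerodivisor on M/(f_1, ..., f_i)M = R/(J + (f_1, ..., f_i)), and       *)
(* M/(f_1, ..., f_r)M is nonzero.                                              *)
Definition quot_regular_seq (R : comNzRingType) (J : R -> Prop) (s : seq R) :
    Prop :=
  (forall i, (i < size s)%N -> forall p,
     ideal_add_seq J (take i s) (s`_i * p) -> ideal_add_seq J (take i s) p) /\
  ~ ideal_add_seq J s 1.

(* The depth (grade) of R/J with respect to the ideal m is d: the maximal      *)
(* length of a regular sequence on R/J with elements in m.                     *)
Definition has_quot_depth (R : comNzRingType) (m J : R -> Prop) (d : nat) :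
    Prop :=
  is_greatest
    (fun l => exists s : seq R,
       [/\ size s = l, forall f, f \in s -> m f & quot_regular_seq J s]) d.

Definition graded_max_ideal (K : fieldType) (N : nat) : {mpoly K[N]} -> Prop :=
  ideal_gen (fun p => exists i : 'I_N, p = 'X_i).

Definition is_monomial_ideal (K : fieldType) (n : nat)
    (I : {mpoly K[n]} -> Prop) : Prop :=
  exists G : 'X_{1..n} -> Prop,
    forall p, I p <-> ideal_gen (fun q => exists m, G m /\ q = 'X_[m]) p.

(* Mon(S \ I), a monomial being represented by its exponent vector. *)
Definition mon_compl (K : fieldType) (n : nat) (I : {mpoly K[n]} -> Prop)
    (m : 'X_{1..n}) : Prop :=
  ~ I 'X_[m].

(* S^\wp is {mpoly K[pvar_count b]}: its variables are indexed by the pairs    *)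
(* (i, j) with i < n and j < b_i, both counted from 0 and enumerated.          *)
Definition pvar_count (n : nat) (b : 'I_n -> nat) : nat :=
  #|{: {i : 'I_n & 'I_(b i)}}|.

Definition pvar (K : fieldType) (n : nat) (b : 'I_n -> nat) (i : 'I_n)
    (j : 'I_(b i)) : {mpoly K[pvar_count b]} :=
  'X_(enum_rank (Tagged (fun i : 'I_n => 'I_(b i)) j)).

(* L(I), generated by the products of the x_{i,a_i+1}; as the second index is  *)
(* counted from 0 here, x_{i,a_i+1} is [pvar] at (i, a_i).  The bound a_i < b_i *)
(* excludes no a with x^a outside I when x_i^(b_i) belongs to I for all i.     *)
Definition L_ideal (K : fieldType) (n : nat) (I : {mpoly K[n]} -> Prop)
    (b : 'I_n -> nat) : {mpoly K[pvar_count b]} -> Prop :=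
  ideal_gen (fun p =>
    exists (a : 'X_{1..n}) (lt_ab : forall i, (a i < b i)%N),
      mon_compl I a /\ p = \prod_(i < n) pvar K (Ordinal (lt_ab i))).

Definition has_L_depth (K : fieldType) (n : nat) (I : {mpoly K[n]} -> Prop)
    (b : 'I_n -> nat) (k d : nat) : Prop :=
  has_quot_depth (@graded_max_ideal K (pvar_count b))
    (ideal_pow (@L_ideal K n I b) k) d.

Definition lcm_degree (K : fieldType) (n : nat) (I : {mpoly K[n]} -> Prop)
    (k l : nat) : Prop :=
  exists u : 'I_k -> 'X_{1..n},
    (forall j, mon_compl I (u j)) /\
    l = mdeg (\big[@mlcm n/0%MM]_(j < k) u j).

(* Main.v *)
Require Import Defs.
From mathcomp Require Import all_boot all_order all_algebra.
From mathcomp Require Import boolp.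
From mathcomp.multinomials Require Import mpoly.
From mathcomp Require Import zify ring.

Set Implicit Arguments.
Unset Strict Implicit.
Unset Printing Implicit Defensive.

Import Order.TTheory GRing.Theory.
Local Open Scope ring_scope.

(* Write N for the number of variables x_{i,j} of S^wp. The ideal L(I)^k is
   generated by monomials of degree k in each group x_{i,1}, ..., x_{i,b_i}, and
   their set is closed under lowering second indices. For such a generator u let
   V_u be the set of variables strictly below a variable of the same group that
   divides u; for u coming from u_1, ..., u_k it has deg lcm(u_1, ..., u_k) elements.

   Depth is compared with the vanishing of the Koszul homology of S^wp/L(I)^k.
   Adding the generators by increasing weight gives linear quotients with colon
   ideals (V_u), so H_i = 0 for i > q + 1, where q = max |V_u|. This produces a
   regular sequence of length N - q - 1: as long as the top homology vanishes
   there is no socle, and then prime avoidance gives a regular element.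

   Conversely, a regular sequence of length l forces H_i = 0 for i > N - l, while
   every generator u yields an explicit nonzero class in degree |V_u| + 1: with t_i
   the largest variable of group i in u, it is u / (t_1 ... t_n) times the
   boundaries of the top forms of all groups but one, cut off at t_i, times the
   top form of the remaining group. *)

(** * Ideals as predicates, and regular sequences *)

Section Ideals.
Variable R : comNzRingType.
Implicit Types (J Q : R -> Prop) (f p q : R).

(** For an ideal [Q] this is Q + (f); the Koszul arguments work with the explicit cofactor [r]. *)
Definition ideal_add1 Q f p := exists r, Q (p - f * r).
Definition colon Q f p := Q (f * p).
Definition regular_mod Q f := forall p, Q (f * p) -> Q p.

Lemma ideal0 Q : is_ideal Q -> Q 0. Proof. by case. Qed.
Lemma idealD Q p q : is_ideal Q -> Q p -> Q q -> Q (p + q).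
Proof. by case=> _ H _; apply: H. Qed.
Lemma idealMl Q a p : is_ideal Q -> Q p -> Q (a * p).
Proof. by case=> _ _; apply. Qed.
Lemma idealN Q p : is_ideal Q -> Q p -> Q (- p).
Proof. by move=> Q_id Qp; rewrite -mulN1r; apply: idealMl. Qed.
Lemma idealB Q p q : is_ideal Q -> Q p -> Q q -> Q (p - q).
Proof. by move=> Q_id Qp Qq; apply: idealD => //; apply: idealN. Qed.
Lemma ideal_sum Q (T : Type) (s : seq T) (P : pred T) (F : T -> R) :
  is_ideal Q -> (forall i, P i -> Q (F i)) -> Q (\sum_(i <- s | P i) F i).
Proof.
move=> Q_id QF; apply: big_ind => //; first exact: ideal0.
by move=> x y; apply: idealD.
Qed.

Lemma ideal_gen_ideal (A : R -> Prop) : is_ideal (ideal_gen A).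
Proof.
split=> [J J_id _|p q Ap Aq J J_id AJ|a p Ap J J_id AJ].
- exact: ideal0.
- by apply: idealD => //; [apply: Ap | apply: Aq].
- by apply: idealMl => //; apply: Ap.
Qed.

Lemma ideal_gen_incl (A : R -> Prop) p : A p -> ideal_gen A p.
Proof. by move=> Ap J _; apply. Qed.

Lemma ideal_add1_ideal Q f : is_ideal Q -> is_ideal (ideal_add1 Q f).
Proof.
move=> Q_id; split=> [|p q [r Qp] [s Qq]|a p [r Qp]].
- by exists 0; rewrite mulr0 subr0; apply: ideal0.
- exists (r + s); rewrite (_ : _ - _ = (p - f * r) + (q - f * s)); last by ring.
  exact: idealD.
- exists (a * r); rewrite (_ : _ - _ = a * (p - f * r)); last by ring.
  exact: idealMl.
Qed.

Lemma ideal_add1_sub Q f p : Q p -> ideal_add1 Q f p.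
Proof. by exists 0; rewrite mulr0 subr0. Qed.

Lemma ideal_add1_mem Q f r : is_ideal Q -> ideal_add1 Q f (f * r).
Proof. by exists r; rewrite subrr; apply: ideal0. Qed.

Lemma colon_ideal Q f : is_ideal Q -> is_ideal (colon Q f).
Proof.
rewrite /colon => Q_id; split=> [|p q Qp Qq|a p Qp].
- by rewrite mulr0; apply: ideal0.
- by rewrite mulrDr; apply: idealD.
- by rewrite mulrCA; apply: idealMl.
Qed.

Lemma ideal_add_seq_nil Q : is_ideal Q -> ideal_add_seq Q [::] = Q.
Proof.
move=> Q_id; apply/funext => p; apply/propext; split=> [|Qp].
  by apply=> // q [].
by apply: ideal_gen_incl; left.
Qed.

Lemma ideal_add_seq_cons Q f s : is_ideal Q ->
  ideal_add_seq Q (f :: s) = ideal_add_seq (ideal_add1 Q f) s.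
Proof.
move=> Q_id; apply/funext => p; apply/propext; split; apply.
- exact: ideal_gen_ideal.
- move=> q [Qq|]; first by apply: ideal_gen_incl; left; apply: ideal_add1_sub.
  rewrite inE => /orP[/eqP->|sq]; apply: ideal_gen_incl; last by right.
  by left; exists 1; rewrite mulr1 subrr; apply: ideal0.
- exact: ideal_gen_ideal.
- move=> q [[r Qr]|sq]; last by apply: ideal_gen_incl; right; rewrite inE sq orbT.
  have A_id := ideal_gen_ideal (fun p => Q p \/ p \in f :: s).
  rewrite -(subrK (f * r) q); apply: (idealD A_id).
    by apply: ideal_gen_incl; left.
  rewrite mulrC; apply: (idealMl _ A_id).
  by apply: ideal_gen_incl; right; rewrite mem_head.
Qed.

(** With this, inductions on a regular sequence change the ideal instead of the position in the
    sequence. *)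
Lemma quot_regular_seq_cons Q f s : is_ideal Q ->
  quot_regular_seq Q (f :: s) <->
  regular_mod Q f /\ quot_regular_seq (ideal_add1 Q f) s.
Proof.
move=> Q_id; rewrite /quot_regular_seq ideal_add_seq_cons //; split.
  move=> [reg n1]; split; last split=> // i lt_is p.
    by move=> p; move: (reg 0%N isT p); rewrite take0 ideal_add_seq_nil.
  by move: (reg i.+1 lt_is p); rewrite /= ideal_add_seq_cons.
case=> regf [reg n1]; split=> // -[|i] lt_is p /=.
  by rewrite ideal_add_seq_nil //; apply: regf.
by rewrite ideal_add_seq_cons //; apply: reg.
Qed.

End Ideals.

(** * Koszul homology *)

Section ExteriorOperators.
Variables (R : comNzRingType) (N : nat).
Implicit Types (s : {set 'I_N}) (v w : 'I_N) (a b : 'I_N -> R) (z y : {set 'I_N} -> R).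

(* The element \sum_s z(s) e_s of the exterior algebra is encoded as [z]. *)
Definition ext_sign v s : R := (-1) ^+ #|[set w in s | (w < v)%N]|.

Definition contract1 v z : {set 'I_N} -> R :=
  fun s => if v \in s then 0 else ext_sign v s * z (v |: s).
Definition wedge1 v z : {set 'I_N} -> R :=
  fun s => if v \in s then ext_sign v s * z (s :\ v) else 0.
(** [contract1 v] is contraction with the dual of e_v, so for [a] the sequence of variables this is
    the Koszul differential, written d below. *)
Definition contract a z : {set 'I_N} -> R := fun s => \sum_v a v * contract1 v z s.
Definition wedge b z : {set 'I_N} -> R := fun s => \sum_v b v * wedge1 v z s.

Definition supp_card (i : nat) z := forall s, #|s| <> i -> z s = 0.

Lemma ext_sign_setU v w s : v \notin s -> ext_sign w (v |: s) = (-1) ^+ (v < w)%N * ext_sign w s.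
Proof.
move=> vs; rewrite /ext_sign -exprD; congr (_ ^+ _).
have [vw|wv] := boolP (v < w)%N.
  rewrite (_ : [set _ in _ | _] = v |: [set u in s | (u < w)%N]).
    by rewrite cardsU1 inE (negPf vs).
  by apply/setP=> u; rewrite !inE; case: eqP => [->|] //=; rewrite vw.
rewrite add0n; congr #|pred_of_set _|; apply/setP=> u; rewrite !inE.
by case: eqP => [->|] //=; rewrite (negPf wv) andbF.
Qed.

Lemma ext_sign_setD v w s : v \in s -> ext_sign w (s :\ v) = (-1) ^+ (v < w)%N * ext_sign w s.
Proof.
move=> vs; rewrite -{2}(setD1K vs) ext_sign_setU ?setD11 //.
by rewrite mulrA -signr_addb addbb mul1r.
Qed.

Lemma ext_sign_sqr v s : ext_sign v s * ext_sign v s = 1.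
Proof. by rewrite /ext_sign -exprD -signr_odd oddD addbb. Qed.

Lemma contract1C v w z s : contract1 v (contract1 w z) s = - contract1 w (contract1 v z) s.
Proof.
rewrite /contract1; have [->|nvw] := eqVneq v w.
  by rewrite setU11; case: ifP; rewrite ?mulr0 ?oppr0.
rewrite !inE (negPf nvw) (eq_sym w) (negPf nvw) /=.
have [vs|vs] := boolP (v \in s); have [ws|ws] := boolP (w \in s);
  rewrite ?mulr0 ?oppr0 //.
rewrite !ext_sign_setU // setUCA.
suff -> : ((-1) ^+ (v < w)%N : R) = - (-1) ^+ (w < v)%N by ring.
have /orP[h|h] : (v < w)%N || (w < v)%N by rewrite -neq_ltn.
  by rewrite h ltnNge ltnW.
by rewrite h ltnNge ltnW // expr0 expr1 opprK.
Qed.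

Lemma contract1_contract1 v z s : contract1 v (contract1 v z) s = 0.
Proof. by rewrite /contract1 setU11; case: ifP; rewrite ?mulr0. Qed.

Lemma contract1_wedge1 v w z s :
  contract1 v (wedge1 w z) s + wedge1 w (contract1 v z) s = if v == w then z s else 0.
Proof.
rewrite /contract1 /wedge1; have [<-|nvw] := eqVneq v w.
  rewrite setU11 setD11; have [vs|vs] := boolP (v \in s).
    rewrite (setD1K vs) ext_sign_setD // ltnn mul1r mulrA ext_sign_sqr; ring.
  by rewrite setU1K // ext_sign_setU // ltnn mul1r mulrA ext_sign_sqr addr0 mul1r.
rewrite !inE nvw eq_sym (negPf nvw) /=.
have [vs|vs] := boolP (v \in s); have [ws|ws] := boolP (w \in s);
  rewrite ?mulr0 ?addr0 //.
rewrite ext_sign_setU // ext_sign_setD //.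
have -> : (v |: s) :\ w = v |: (s :\ w).
  by apply/setP=> u; rewrite !inE; case: (eqVneq u v) => [->|]; rewrite ?nvw.
suff -> : ((-1) ^+ (v < w)%N : R) = - (-1) ^+ (w < v)%N by ring.
have /orP[h|h] : (v < w)%N || (w < v)%N by rewrite -neq_ltn.
  by rewrite h ltnNge ltnW.
by rewrite h ltnNge ltnW // expr0 expr1 opprK.
Qed.

Lemma contract1_sum v (T : finType) (c : T -> R) (F : T -> {set 'I_N} -> R) s :
  contract1 v (fun s => \sum_t c t * F t s) s = \sum_t c t * contract1 v (F t) s.
Proof.
rewrite /contract1; case: ifP => _; first by rewrite big1 // => t _; rewrite mulr0.
by rewrite mulr_sumr; apply: eq_bigr => t _; rewrite mulrCA.
Qed.

Lemma wedge1_sum v (T : finType) (c : T -> R) (F : T -> {set 'I_N} -> R) s :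
  wedge1 v (fun s => \sum_t c t * F t s) s = \sum_t c t * wedge1 v (F t) s.
Proof.
rewrite /wedge1; case: ifP => _; last by rewrite big1 // => t _; rewrite mulr0.
by rewrite mulr_sumr; apply: eq_bigr => t _; rewrite mulrCA.
Qed.

Lemma contractC a b z s : contract a (contract b z) s = - contract b (contract a z) s.
Proof.
rewrite /contract; under eq_bigr => v _ do rewrite contract1_sum mulr_sumr.
rewrite exchange_big -sumrN; apply: eq_bigr => w _ /=.
rewrite contract1_sum mulr_sumr -sumrN; apply: eq_bigr => v _.
by rewrite contract1C; ring.
Qed.

(* [contractC] alone does not give this in characteristic 2. *)
Lemma contract_contract a z s : contract a (contract a z) s = 0.
Proof.
rewrite /contract; under eq_bigr => v _ do rewrite contract1_sum mulr_sumr.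
pose F v w := a v * (a w * contract1 v (contract1 w z) s).
have FC v w : F v w = - F w v by rewrite /F contract1C; ring.
have F0 v : F v v = 0 by rewrite /F contract1_contract1 !mulr0.
rewrite -[LHS]/(\sum_v \sum_w F v w).
(* Split the double sum at the diagonal: the diagonal vanishes by [F0], and the two halves cancel by
   [FC]. *)
rewrite (eq_bigr (fun v : 'I_N => \sum_(w : 'I_N | (v < w)%N) F v w +
    \sum_(w : 'I_N | ~~ (v < w)%N) F v w)); last first.
  by move=> v _; rewrite (bigID (fun w : 'I_N => (v < w)%N)).
rewrite big_split /=.
rewrite [X in _ + X](eq_bigr (fun v : 'I_N => \sum_(w : 'I_N | (w < v)%N) F v w)); last first.
  move=> v _; rewrite [LHS](bigD1 v) ?ltnn //= F0 add0r; apply: eq_bigl => w.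
  by rewrite -leqNgt ltn_neqAle andbC.
rewrite [X in _ + X](exchange_big_dep predT) //= -big_split /=.
apply: big1 => v _; rewrite -big_split; apply: big1 => w _ /=.
by rewrite FC addNr.
Qed.

(** Contraction is an antiderivation, so [wedge b] is a homotopy from multiplication by the pairing
    of [a] and [b] to zero. *)
Lemma contract_wedge a b z s :
  contract a (wedge b z) s + wedge b (contract a z) s = (\sum_v a v * b v) * z s.
Proof.
rewrite /contract /wedge; under eq_bigr => v _ do rewrite contract1_sum mulr_sumr.
under [X in _ + X]eq_bigr => v _ do rewrite wedge1_sum mulr_sumr.
rewrite [X in _ + X]exchange_big -big_split mulr_suml; apply: eq_bigr => v _ /=.
rewrite -big_split (bigD1 v) //= big1 ?addr0 => [|w nwv].
  rewrite -[in RHS](_ : contract1 v (wedge1 v z) s + wedge1 v (contract1 v z) s = z s).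
    by ring.
  by rewrite contract1_wedge1 eqxx.
have := contract1_wedge1 v w z s; rewrite eq_sym (negPf nwv) => /(canRL (addrK _)) ->.
by ring.
Qed.

Lemma contractD a z y s : contract a (fun s => z s + y s) s = contract a z s + contract a y s.
Proof.
rewrite -big_split; apply: eq_bigr => v _ /=.
by rewrite /contract1; case: ifP => _; ring.
Qed.

Lemma contractZ a c z s : contract a (fun s => c * z s) s = c * contract a z s.
Proof.
rewrite mulr_sumr; apply: eq_bigr => v _ /=.
by rewrite /contract1; case: ifP => _; ring.
Qed.

Lemma contractB a z y s : contract a (fun s => z s - y s) s = contract a z s - contract a y s.
Proof.
rewrite contractD -[X in _ = _ + X]mulN1r -contractZ; congr (_ + _).
by congr contract; apply/funext=> t; rewrite mulN1r.
Qed.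

Lemma contract_supp i a z : supp_card i.+1 z -> supp_card i (contract a z).
Proof.
move=> zi s si; apply: big1 => v _; rewrite /contract1; case: ifPn => vs.
  by rewrite mulr0.
by rewrite zi ?mulr0 // cardsU1 vs => -[].
Qed.

Lemma wedge_supp i b z : supp_card i z -> supp_card i.+1 (wedge b z).
Proof.
move=> zi s si; apply: big1 => v _; rewrite /wedge1; case: ifPn => vs.
  by rewrite zi ?mulr0 // => si'; apply: si; rewrite (cardsD1 v) vs si'.
by rewrite mulr0.
Qed.

Lemma contract_ideal Q a z : is_ideal Q -> (forall s, Q (z s)) -> forall s, Q (contract a z s).
Proof.
move=> Q_id Qz s; apply: ideal_sum => // v _; apply: idealMl => //.
by rewrite /contract1; case: ifP => _; [apply: ideal0 | apply: idealMl].
Qed.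

Lemma wedge_ideal Q b z : is_ideal Q -> (forall s, Q (z s)) -> forall s, Q (wedge b z s).
Proof.
move=> Q_id Qz s; apply: ideal_sum => // v _; apply: idealMl => //.
by rewrite /wedge1; case: ifP => _; [apply: idealMl | apply: ideal0].
Qed.

End ExteriorOperators.

Section KoszulBound.
Variables (R : comNzRingType) (N : nat) (x : 'I_N -> R).
Implicit Types (Q : R -> Prop) (f p q : R) (h i : nat) (z y : {set 'I_N} -> R).

(* The Koszul homology H_i(x; R/Q) vanishes for all i > h. *)
Definition koszul_vanish Q h := forall i z, (h < i)%N -> supp_card i z ->
  (forall s, Q (contract x z s)) ->
  exists2 y, supp_card i.+1 y & forall s, Q (z s - contract x y s).

Lemma koszul_vanishW Q h h' : (h <= h')%N -> koszul_vanish Q h -> koszul_vanish Q h'.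
Proof. by move=> le_hh' Qh i z lt_hi; apply: Qh; apply: leq_ltn_trans lt_hi. Qed.

Lemma koszul_vanish_N Q h : is_ideal Q -> (N <= h)%N -> koszul_vanish Q h.
Proof.
move=> Q_id le_Nh i z lt_hi zi _; exists (fun=> 0) => // s.
rewrite zi => [|si]; last first.
  by have := max_card (mem s); rewrite si card_ord leqNgt (leq_ltn_trans le_Nh).
rewrite -[X in contract x X]/(fun=> 0) (_ : contract _ _ _ = 0) ?subr0; first exact: ideal0.
by apply: big1 => v _; rewrite /contract1; case: ifP; rewrite !mulr0.
Qed.

Lemma ideal_add1_choice Q f i z : is_ideal Q -> supp_card i z ->
  (forall s, ideal_add1 Q f (z s)) ->
  exists2 y, supp_card i y & forall s, Q (z s - f * y s).
Proof.
move=> Q_id zi Qz; have /choice[y yP] := Qz.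
(* The cutoff at cardinality [i] makes the chosen cofactors homogeneous. *)
exists (fun s : {set 'I_N} => if #|s| == i then y s else 0) => s; first by case: eqP.
by case: eqP => [_|/zi ->] //; rewrite mulr0 subr0; apply: ideal0.
Qed.

(* [f] acts as zero on Koszul homology, [wedge g] being a homotopy. *)
Lemma koszul_vanish_regular Q f h : is_ideal Q -> regular_mod Q f ->
  (exists g, f = \sum_v x v * g v) -> koszul_vanish (ideal_add1 Q f) h.+1 ->
  koszul_vanish Q h.
Proof.
move=> Q_id regf [g def_f] van i z lt_hi zi Qz.
have htp s : f * z s - contract x (wedge g z) s = wedge g (contract x z) s.
  by rewrite def_f -contract_wedge; ring.
have Qhtp s : Q (f * z s - contract x (wedge g z) s).
  by rewrite htp; apply: wedge_ideal.
(* By the homotopy, d (wedge g z) is f z modulo Q. So [wedge g z] is a cycle modulo Q + (f), hence a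
   boundary there. *)
have [|s|t ti tP] := van i.+1 (wedge g z) lt_hi.
- exact: wedge_supp.
- exists (z s).
  by rewrite -opprB; apply: idealN.
have wi : supp_card i.+1 (fun s => wedge g z s - contract x t s).
  by move=> s si; rewrite (wedge_supp _ zi) // (contract_supp _ ti) // subrr.
have [y yi yP] := ideal_add1_choice Q_id wi tP.
(* Applying d to wedge g z - d t - f y and using d d = 0 shows that f (z - d y) lies in Q;
   regularity cancels [f]. *)
exists y => // s; apply: regf.
rewrite (_ : _ * _ = (f * z s - contract x (wedge g z) s) +
   contract x (fun s => wedge g z s - contract x t s - f * y s) s); last first.
  by rewrite !contractB contractZ contract_contract; ring.
by apply: idealD => //; apply: contract_ideal.
Qed.

(** This unwinds the long exact sequence of 0 -> R/(Q : f) -> R/Q -> R/(Q + (f)) -> 0, whose first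
    map is multiplication by [f]. *)
Lemma koszul_vanish_cone Q f h : is_ideal Q -> koszul_vanish Q h.+1 ->
  koszul_vanish (colon Q f) h -> koszul_vanish (ideal_add1 Q f) h.+1.
Proof.
move=> Q_id vanQ vanC [|i] // z lt_hi zi Qz.
have [y yi yP] := ideal_add1_choice Q_id (@contract_supp _ _ i x z zi) Qz.
(* [y] represents the image of [z] under the connecting map. Once [t] bounds it modulo Q : f, the
   difference z - f t is a cycle modulo Q. *)
have [s|t ti tP] := vanC i y lt_hi yi.
- rewrite /colon -contractZ.
  rewrite -[X in contract x X](_ : (fun s => contract x z s - (contract x z s - f * y s)) = _).
    by rewrite contractB contract_contract sub0r; apply: idealN => //; apply: contract_ideal.
  by apply/funext=> t; ring.
have [||u ui uP] := vanQ i.+1 (fun s => z s - f * t s) lt_hi.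
- by move=> s si; rewrite zi // ti // mulr0 subrr.
- move=> s; rewrite contractB contractZ.
  rewrite (_ : _ - _ = (contract x z s - f * y s) + f * (y s - contract x t s)); last by ring.
  by apply: idealD => //; apply: tP.
exists u => // s; exists (t s).
by rewrite (_ : _ - _ = z s - f * t s - contract x u s); last ring.
Qed.

(* A socle element of R/Q is a Koszul cycle of top degree. *)
Lemma koszul_vanish_socle Q h p : is_ideal Q -> koszul_vanish Q h -> (h < N)%N ->
  (forall v, Q (x v * p)) -> Q p.
Proof.
move=> Q_id van lt_hN Qp.
pose z (s : {set 'I_N}) := if s == setT then p else 0.
have [s|s|y yN yP] := van N z lt_hN.
- by rewrite /z; case: eqP => // ->; rewrite cardsT card_ord.
- apply: ideal_sum => // v _; rewrite /contract1 /z; case: ifP => _.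
    by rewrite mulr0; apply: ideal0.
  by case: eqP => _; rewrite ?mulr0; [rewrite mulrCA; apply: idealMl | apply: ideal0].
(* No [v] lies outside the full set, so d y has coefficient 0 there. *)
move: (yP setT); rewrite /z eqxx (_ : contract _ _ _ = 0) ?subr0 //.
by apply: big1 => v _; rewrite /contract1 inE mulr0.
Qed.

End KoszulBound.

(** * Existence of regular sequences *)

Section RegularSequences.
Variables (R : comNzRingType) (N : nat) (x : 'I_N -> R).
Implicit Types (Q : R -> Prop) (f p q : R) (h e : nat) (s : seq R).

Definition var_ideal p := exists g, p = \sum_v x v * g v.

Lemma var_ideal_ideal : is_ideal var_ideal.
Proof.
split=> [|p q [g ->] [g' ->]|a p [g ->]].
- by exists (fun=> 0); rewrite big1 // => v _; rewrite mulr0.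
- exists (fun v => g v + g' v); rewrite -big_split.
  by apply: eq_bigr => v _; rewrite mulrDr.
- exists (fun v => a * g v); rewrite mulr_sumr.
  by apply: eq_bigr => v _; rewrite mulrCA.
Qed.

Lemma var_ideal_var v : var_ideal (x v).
Proof.
exists (fun w => (w == v)%:R); rewrite (bigD1 v) //= eqxx mulr1 big1 ?addr0 //.
by move=> w /negPf->; rewrite mulr0.
Qed.

(** Modulo the whole sequence nothing lives above exterior degree [N]; each regular element removed
    lowers the bound by one. *)
Lemma regular_seq_koszul_vanish Q s h : is_ideal Q ->
  (forall f, f \in s -> var_ideal f) -> quot_regular_seq Q s ->
  (N <= h + size s)%N -> koszul_vanish x Q h.
Proof.
elim: s Q h => [|f s IHs] Q h Q_id sM; first by rewrite addn0 => _; apply: koszul_vanish_N.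
move=> /(quot_regular_seq_cons _ _ Q_id)[regf reg_s] /= le_N.
apply: (koszul_vanish_regular Q_id regf); first by apply: sM; rewrite mem_head.
apply: IHs => //; first exact: ideal_add1_ideal.
  by move=> g sg; apply: sM; rewrite inE sg orbT.
by rewrite addSnnS.
Qed.

Definition noetherian := forall F : (R -> Prop) -> Prop,
  (forall J, F J -> is_ideal J) -> (exists J, F J) ->
  exists2 J, F J & forall J', F J' -> (forall p, J p -> J' p) -> forall p, J' p -> J p.

(** (Q : p) is maximal among the annihilators of nonzero elements of R/Q. Such annihilators are
    associated primes, represented here by the witness [p]. *)
Definition max_annihilator Q p := ~ Q p /\
  forall q, ~ Q q -> (forall r, Q (p * r) -> Q (q * r)) -> forall r, Q (q * r) -> Q (p * r).

(** Every zero divisor modulo [Q] therefore lies in some maximal annihilator. *)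
Lemma ex_max_annihilator Q q : noetherian -> is_ideal Q -> ~ Q q ->
  exists2 p, max_annihilator Q p & forall r, Q (q * r) -> Q (p * r).
Proof.
move=> noeth Q_id nQq.
have [||J [p [nQp [-> qp]]] maxJ] := noeth (fun J => exists p,
  ~ Q p /\ J = colon Q p /\ forall r, Q (q * r) -> Q (p * r)).
- by move=> _ [p [_ [-> _]]]; apply: colon_ideal.
- by exists (colon Q q), q.
exists p => //; split=> // p' nQp' pp'; apply: (maxJ (colon Q p') _ pp').
by exists p'; split=> //; split=> // r /qp /pp'.
Qed.

(** If p a is not in [Q], then (Q : p a) contains (Q : p) and equals it by maximality. *)
Lemma max_annihilator_prime Q p a b : is_ideal Q ->
  max_annihilator Q p -> Q (p * (a * b)) -> ~ Q (p * a) -> Q (p * b).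
Proof.
move=> Q_id [_ maxp] Qpab nQpa; apply: (maxp (p * a)) => //; last by rewrite -mulrA.
by move=> r Qpr; rewrite mulrAC mulrC; apply: idealMl.
Qed.

(** Take one element of each (Q : q) outside the prime (Q : p) and multiply them. *)
Lemma max_annihilator_avoid Q p s : is_ideal Q -> max_annihilator Q p ->
  (forall q, q \in s -> exists2 a, Q (q * a) & ~ Q (p * a)) ->
  exists2 a, ~ Q (p * a) & forall q, q \in s -> Q (q * a).
Proof.
move=> Q_id maxp; elim: s => [|q s IHs] sP; first by exists 1; rewrite ?mulr1 //; case: maxp.
have [q' sq'|a nQpa Qsa] := IHs; first by apply: sP; rewrite inE sq' orbT.
have [b Qqb nQpb] := sP q (mem_head _ _).
exists (a * b) => [Qpab|q']; first exact: nQpb (max_annihilator_prime Q_id maxp Qpab nQpa).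
rewrite inE => /orP[/eqP->|/Qsa Qqa]; first by rewrite mulrCA; apply: idealMl.
by rewrite mulrA mulrC; apply: idealMl.
Qed.

(** Choose the witnesses [s] with Q + (s) maximal, so that every further witness [p] lies in Q +
    (s). If no (Q : q) were inside (Q : p), some [a] would kill all of [s] but not [p], a
    contradiction. *)
Lemma max_annihilator_finite Q : noetherian -> is_ideal Q ->
  exists2 s : seq R, (forall q, q \in s -> max_annihilator Q q) &
    forall p, max_annihilator Q p ->
      exists2 q, q \in s & forall r, Q (q * r) -> Q (p * r).
Proof.
move=> noeth Q_id.
have [||J [s [maxs ->]] maxJ] := noeth (fun J => exists s : seq R,
  (forall q, q \in s -> max_annihilator Q q) /\ J = ideal_add_seq Q s).
- by move=> _ [s [_ ->]]; apply: ideal_gen_ideal.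
- by exists (ideal_add_seq Q [::]), [::].
exists s => // p maxp; apply: contrapT => noq.
have [q sq|a nQpa Qsa] := max_annihilator_avoid Q_id maxp (s := s).
  apply: contrapT => noa; apply: noq; exists q => // r Qqr.
  by apply: contrapT => nQpr; apply: noa; exists r.
suff : ideal_add_seq Q s p.
  move=> /(_ _ (colon_ideal a Q_id)) Qpa; apply: nQpa.
  rewrite mulrC; apply: Qpa => q; rewrite /colon => -[Qq|/Qsa].
    exact: idealMl.
  by rewrite mulrC.
apply: (maxJ (ideal_add_seq Q (p :: s))).
- exists (p :: s); split=> // q; rewrite inE => /orP[/eqP->//|]; exact: maxs.
- move=> q; apply; first exact: ideal_gen_ideal.
  move=> r Qsr; apply: ideal_gen_incl; case: Qsr => [|sr]; first by left.
  by right; rewrite inE sr orbT.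
- by apply: ideal_gen_incl; right; rewrite mem_head.
Qed.

(* Prime avoidance for the finitely many maximal annihilators. *)
Lemma ex_regular_mod Q (M : R -> Prop) : noetherian -> is_ideal Q -> is_ideal M ->
  (forall p, (forall f, M f -> Q (p * f)) -> Q p) ->
  exists2 f, M f & regular_mod Q f.
Proof.
move=> noeth Q_id M_id no_socle.
have [s maxs sP] := max_annihilator_finite noeth Q_id.
suff [f Mf nQf] : exists2 f, M f & forall q, q \in s -> ~ Q (q * f).
  exists f => // p Qfp; apply: contrapT => nQp.
  have [q maxq qP] := ex_max_annihilator noeth Q_id nQp.
  have [q' sq' q'P] := sP q maxq; apply: (nQf q' sq').
  by apply: (maxs q' sq').2 q'P _ _; [case: maxq | apply: qP; rewrite mulrC].
elim: s maxs {sP} => [|p s IHs] maxs; first by exists 0 => //; apply: ideal0.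
have [q sq|f Mf nQf] := IHs; first by apply: maxs; rewrite inE sq orbT.
have maxp := maxs p (mem_head _ _).
have [Qpf|nQpf] := pselect (Q (p * f)); last first.
  by exists f => // q; rewrite inE => /orP[/eqP->|/nQf].
have [b Mb nQpb] : exists2 b, M b & ~ Q (p * b).
  apply: contrapT => nob; apply: maxp.1; apply: no_socle => b Mb.
  by apply: contrapT => nQpb; apply: nob; exists b.
(* If (Q : q) were inside (Q : p), maximality of [q] would make them equal, and [f], which kills
   [p], would kill [q]. *)
have [q sq|a nQpa Qsa] := max_annihilator_avoid Q_id maxp (s := s).
  apply: contrapT => noa; apply: (nQf q sq).
  apply: (maxs q _).2 Qpf => [||r Qqr]; first by rewrite inE sq orbT.
    exact: maxp.1.
  by apply: contrapT => nQpr; apply: noa; exists r.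
have nQpab : ~ Q (p * (a * b)) by move/(max_annihilator_prime Q_id maxp)/(_ nQpa).
(* The correction a b kills every [q] in [s], so nothing changes there. It does not kill [p],
   whereas [f] does. *)
exists (f + a * b) => [|q]; first by apply: idealD => //; apply: idealMl.
rewrite inE => /orP[/eqP->|sq] Qq.
  by apply: nQpab; rewrite -(addKr (p * f) (p * _)) addrC -mulrDr; apply: idealB.
apply: (nQf q sq); rewrite -(addrK (q * (a * b)) (q * f)) -mulrDr.
apply: idealB => //; rewrite mulrA mulrC; apply: idealMl => //; exact: Qsa.
Qed.

(** Each new regular element raises the bound [h] by one, because the cone lemma applies with (Q :
    f) = Q. The bound h + e <= N keeps [h] below [N], as the socle argument requires, until [e]
    elements are found. *)
Lemma ex_regular_seq Q h e : noetherian -> ~ var_ideal 1 -> is_ideal Q ->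
  (forall p, Q p -> var_ideal p) -> koszul_vanish x Q h -> (h + e <= N)%N ->
  exists s : seq R, [/\ size s = e, forall f, f \in s -> var_ideal f & quot_regular_seq Q s].
Proof.
move=> noeth M1; elim: e Q h => [|e IHe] Q h Q_id QM van le_N.
  by exists [::]; split=> //; split=> //; rewrite ideal_add_seq_nil // => /QM.
have [p Qp|f Mf regf] := ex_regular_mod noeth Q_id var_ideal_ideal.
  apply: (koszul_vanish_socle Q_id van) => [|v].
    by rewrite (leq_trans _ le_N) // addnS ltnS leq_addr.
  by rewrite mulrC; apply: Qp; apply: var_ideal_var.
have [||||s [size_s sM reg_s]] := IHe (ideal_add1 Q f) h.+1.
- exact: ideal_add1_ideal.
- move=> p [r /QM Mr]; rewrite -(subrK (f * r) p); apply: idealD => //.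
    exact: var_ideal_ideal.
  by rewrite mulrC; apply: idealMl => //; apply: var_ideal_ideal.
- apply: koszul_vanish_cone => //; first exact: koszul_vanishW van.
  rewrite (_ : colon Q f = Q) //; apply/funext => p; apply/propext.
  by split=> [/regf //|Qp]; apply: idealMl.
- by rewrite addSnnS.
exists (f :: s); split=> /=; first by rewrite size_s.
  by move=> g; rewrite inE => /orP[/eqP->|/sM].
by apply/quot_regular_seq_cons.
Qed.

End RegularSequences.

(** * Hilbert's basis theorem by Dickson's lemma and leading monomials *)

Section HilbertBasis.

(** Repeatedly pick an index where [f] attains its minimum over the remaining tail. *)
Lemma nondecreasing_subsequence (f : nat -> nat) :
  exists2 phi : nat -> nat, (forall i j, (i < j)%N -> (phi i < phi j)%N) &
    forall i j, (i <= j)%N -> (f (phi i) <= f (phi j))%N.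
Proof.
have min_from k : exists i, (k <= i)%N /\ forall j, (k <= j)%N -> (f i <= f j)%N.
  have exk : exists m, `[< exists2 i, (k <= i)%N & f i = m >].
    by exists (f k); apply/asboolP; exists k.
  case: (ex_minnP exk) => m /asboolP[i le_ki <-] min_i.
  by exists i; split=> // j le_kj; apply: min_i; apply/asboolP; exists j.
have /choice[g gP] := min_from.
pose phi := fix phi i := if i is i'.+1 then g (phi i').+1 else g 0%N.
have phiS i : (phi i < phi i.+1)%N by case: (gP (phi i).+1).
have phi_lt i j : (i < j)%N -> (phi i < phi j)%N.
  elim: j => // j IHj; rewrite ltnS leq_eqVlt => /orP[/eqP->|/IHj /ltn_trans]; last exact.
  exact: phiS.
have phi_min i j : (phi i <= j)%N -> (f (phi i) <= f j)%N.
  case: i => [|i] le_ij; first by have [_] := gP 0%N; apply.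
  have [le_g] := gP (phi i).+1; apply.
  by apply: leq_trans le_ij; apply: phiS.
exists phi => // i j; rewrite leq_eqVlt => /orP[/eqP->//|/phi_lt/ltnW].
exact: phi_min.
Qed.

Lemma dickson n (m : nat -> 'X_{1..n}) : exists i j, (i < j)%N /\ (m i <= m j)%MM.
Proof.
(* Subsequences are extracted one coordinate at a time until all coordinates are nondecreasing. *)
suff [phi phi_lt phiP] : exists2 phi : nat -> nat,
    (forall i j, (i < j)%N -> (phi i < phi j)%N) &
    forall c, c \in enum 'I_n -> forall i j, (i <= j)%N -> (m (phi i) c <= m (phi j) c)%N.
  exists (phi 0%N), (phi 1%N); split; first exact: phi_lt.
  by apply/mnm_lepP => c; apply: phiP => //; rewrite mem_enum.
elim: (enum 'I_n) => [|c s [phi phi_lt phiP]]; first by exists id.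
have [psi psi_lt psiP] := nondecreasing_subsequence (fun i => m (phi i) c).
exists (phi \o psi) => [i j /psi_lt /phi_lt //|c'].
rewrite inE => /orP[/eqP->|sc'] i j le_ij; first exact: psiP.
apply: phiP => //; move: le_ij; rewrite leq_eqVlt => /orP[/eqP->//|/psi_lt/ltnW //].
Qed.

Variables (K : fieldType) (N : nat).
Implicit Types (p q f g : {mpoly K[N]}).

Lemma ex_min_mlead (P : {mpoly K[N]} -> Prop) : (exists p, P p) ->
  exists2 p, P p & forall q, P q -> ~~ (mlead q < mlead p)%O.
Proof.
case=> p; elim/mleadrect: p => p IHp Pp.
have [[q [Pq lt_qp]]|nomin] := pselect (exists q, P q /\ (mlead q < mlead p)%O).
  exact: IHp Pq.
by exists p => // q Pq; apply/negP => lt_qp; apply: nomin; exists q.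
Qed.

Lemma mlead_reduce f g : f != 0 -> (mlead f <= mlead g)%MM ->
  exists c, g - c * f = 0 \/ (mlead (g - c * f) < mlead g)%O.
Proof.
have [->|g0] := eqVneq g 0; first by exists 0; rewrite mul0r subrr; left.
move=> f0 le_fg; pose c := (mleadc g / mleadc f) *: 'X_[K, (mlead g - mlead f)].
have lf0 : mleadc f != 0 by rewrite mleadc_eq0.
have lg0 : mleadc g != 0 by rewrite mleadc_eq0.
have lc0 : (mleadc g / mleadc f) * mleadc 'X_[K, mlead g - mlead f] != 0.
  by rewrite mleadXm mcoeffX eqxx mulr1 mulf_neq0 ?invr_eq0.
have lead_c : mlead c = (mlead g - mlead f)%MM by rewrite (mleadZ_proper lc0) mleadXm.
have lc_c : mleadc c = mleadc g / mleadc f.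
  by rewrite lead_c mcoeffZ mcoeffX eqxx mulr1.
have lcf : mleadc c * mleadc f = mleadc g by rewrite lc_c divfK.
have lead_cf : mlead (c * f) = mlead g by rewrite mleadM_proper ?lcf // lead_c submK.
exists c; have [->|h0] := eqVneq (g - c * f) 0; [by left | right].
have := mleadB_le g (c * f); rewrite lead_cf joinxx le_eqVlt => /orP[/eqP eq_l|//].
have := mleadc_eq0 (g - c * f); rewrite (negPf h0) eq_l mcoeffB.
by rewrite -{2}lead_cf mleadcM_proper ?lcf // subrr eqxx.
Qed.

Lemma mpoly_noetherian : noetherian {mpoly K[N]}.
Proof.
move=> F F_id [J0 FJ0]; apply: contrapT => nomax.
have step (J : {J | F J}) : exists J' : {J | F J},
    (forall p, sval J p -> sval J' p) /\ exists p, sval J' p /\ ~ sval J p.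
  case: J => J FJ /=; apply: contrapT => noJ'; apply: nomax; exists J => // J' FJ' JJ' p J'p.
  by apply: contrapT => nJp; apply: noJ'; exists (exist _ J' FJ'); split=> //; exists p.
have /choice[next nextP] := step.
(* A strictly increasing chain of ideals. Each [g i] will have least leading monomial in S (i+1)
   minus S i. Dickson makes one of these monomials divide a later one, and reducing the later
   element contradicts its minimality. *)
pose S i := iter i next (exist _ J0 FJ0).
have S_id i : is_ideal (sval (S i)) by apply: F_id; case: (S i).
have SS i j p : (i <= j)%N -> sval (S i) p -> sval (S j) p.
  elim: j => [|j IHj]; first by rewrite leqn0 => /eqP->.
  by rewrite leq_eqVlt => /orP[/eqP->//|/IHj /[apply]]; apply: (nextP (S j)).1.
have ming i : exists g, (sval (S i.+1) g /\ ~ sval (S i) g) /\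
    forall q, sval (S i.+1) q /\ ~ sval (S i) q -> ~~ (mlead q < mlead g)%O.
  have [g gP ming] := ex_min_mlead (nextP (S i)).2.
  by exists g.
have /choice[g gP] := ming.
have [i [j [lt_ij le_ij]]] := dickson (fun i => mlead (g i)).
have gi0 : g i != 0.
  by apply/eqP => gi0; case: (gP i) => [[_ []]]; rewrite gi0; apply: ideal0.
have Sgi : sval (S j) (g i) by apply: (SS _ _ _ lt_ij); case: (gP i) => [[]].
have [[Sg nSg] mingj] := gP j.
have [c red] := mlead_reduce gi0 le_ij.
have nSr : ~ sval (S j) (g j - c * g i).
  move=> Sr; apply: nSg; rewrite -(subrK (c * g i) (g j)).
  by apply: idealD => //; apply: idealMl.
case: red => [r0|lt_r]; first by apply: nSr; rewrite r0; apply: ideal0.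
suff /mingj/negP : sval (S j.+1) (g j - c * g i) /\ ~ sval (S j) (g j - c * g i) by apply.
split=> //; apply: idealB => //; apply: (SS j _ _ (leqnSn j)); exact: idealMl.
Qed.

End HilbertBasis.

(** * Linear quotients *)

Section MonomialIdeals.
Variables (K : fieldType) (N : nat).
Implicit Types (p : {mpoly K[N]}) (m u g : 'X_{1..N}) (U G : 'X_{1..N} -> Prop).

(** The span of the monomials in [U]. Working with arbitrary sets of exponents turns colons and sums
    of ideals into operations on sets. *)
Definition mono_ideal U p := forall m, m \in msupp p -> U m.
Definition mono_up U := forall m m', U m -> U (m + m')%MM.
Definition upset G m := exists2 g, G g & (g <= m)%MM.

Lemma upset_up G : mono_up (upset G).
Proof.
move=> m m' [g Gg le_gm]; exists g => //.
by apply: lepm_trans le_gm _; apply: lem_addr.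
Qed.

Lemma mono_ideal_ideal U : mono_up U -> is_ideal (mono_ideal U).
Proof.
move=> upU; split=> [m|p q Up Uq m|a p Up m].
- by rewrite msupp0.
- by move=> /msuppD_le; rewrite mem_cat => /orP[/Up|/Uq].
- move=> /msuppM_le/allpairsP[[m1 m2] /= [_ /Up Um2 ->]].
  by rewrite addmC; apply: upU.
Qed.

Lemma mono_idealX U m : mono_ideal U 'X_[m] <-> U m.
Proof.
split=> [|Um m']; first by apply; rewrite msuppX mem_head.
by rewrite msuppX inE => /eqP->.
Qed.

Lemma mono_ideal_sub (J : {mpoly K[N]} -> Prop) U p : is_ideal J ->
  (forall m, U m -> J 'X_[m]) -> mono_ideal U p -> J p.
Proof.
move=> J_id UJ Up; rewrite [p]mpolyE big_seq; apply: ideal_sum => // m /Up/UJ Jm.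
by rewrite -mul_mpolyC; apply: idealMl.
Qed.

Lemma eq_mono_ideal U U' : (forall m, U m <-> U' m) -> mono_ideal U = mono_ideal U'.
Proof. by move=> eqU; congr mono_ideal; apply/funext => m; apply/propext. Qed.

Lemma mono_ideal_gen G :
  ideal_gen (fun p => exists m, G m /\ p = 'X_[m]) = mono_ideal (upset G).
Proof.
apply/funext => p; apply/propext; split.
  apply; first by apply/mono_ideal_ideal/upset_up.
  by move=> _ [m [Gm ->]]; apply/mono_idealX; exists m => //; apply: lepm_refl.
move=> Gp J J_id GJ; apply: mono_ideal_sub Gp => // m [g Gg /submK <-].
by rewrite mpolyXD; apply: idealMl => //; apply: GJ; exists g.
Qed.

Lemma mono_ideal_colon U u :
  colon (mono_ideal U) 'X_[u] = mono_ideal (fun m => U (u + m)%MM).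
Proof.
apply/funext => p; apply/propext; rewrite /colon mulrC; split=> Up m.
  by move=> pm; apply: Up; rewrite (perm_mem (msuppMX _ _)) map_f.
by rewrite (perm_mem (msuppMX _ _)) => /mapP[m' /Up Um' ->].
Qed.

Lemma mono_ideal_add1 U u : mono_up U ->
  ideal_add1 (mono_ideal U) 'X_[u] = mono_ideal (fun m => U m \/ (u <= m)%MM).
Proof.
move=> upU; have U_id := mono_ideal_ideal upU.
apply/funext => p; apply/propext; split=> [[r Ur] m|].
  rewrite -(subrK ('X_[u] * r) p) => /msuppD_le; rewrite mem_cat => /orP[/Ur|]; first by left.
  rewrite mulrC (perm_mem (msuppMX _ _)) => /mapP[m' _ ->].
  by right; apply: lem_addr.
apply: mono_ideal_sub; first exact: ideal_add1_ideal.
move=> m [Um|/submK <-]; first by apply: ideal_add1_sub; apply/mono_idealX.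
by rewrite addmC mpolyXD; apply: ideal_add1_mem.
Qed.

Local Notation X := (fun v : 'I_N => 'X_v : {mpoly K[N]}).

(** [mono_ideal (meets V)] is the ideal generated by the variables in [V]. *)
Definition meets (V : {set 'I_N}) m := exists2 v, v \in V & m v != 0%N.

Lemma meets_up V : mono_up (meets V).
Proof. by move=> m m' [v Vv mv]; exists v; rewrite // mnmDE addn_eq0 (negPf mv). Qed.

(** Descending induction from the full set of variables: a variable outside [V] is regular modulo
    (V), and adding it raises the cardinality by one. *)
Lemma koszul_vanish_vars V : koszul_vanish X (mono_ideal (meets V)) #|V|.
Proof.
have V_id V' := mono_ideal_ideal (@meets_up V').
have [d] := ubnP (N - #|V|)%N; elim: d V => // d IHd V lt_d.
have [->|/eqP nVT] := eqVneq V setT.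
  by apply: koszul_vanish_N => //; rewrite cardsT card_ord.
have [v nVv] : exists v, v \notin V.
  apply: contrapT => noV; apply: nVT; apply/setP => v; rewrite inE.
  by apply/negPn/negP => nVv; apply: noV; exists v.
have V_lt : (#|V| < N)%N.
  rewrite -[N in (_ < N)%N]card_ord -cardsT; apply: proper_card.
  by rewrite properT; apply/eqP.
apply: (@koszul_vanish_regular _ _ _ _ 'X_v) => //.
- move=> p; rewrite -[mono_ideal _ _]/(colon _ _ _) mono_ideal_colon => Vp m /Vp[w Vw].
  rewrite mnmDE mnm1E; have [eq_vw|_] := eqVneq v w; last by exists w.
  by move: nVv; rewrite eq_vw Vw.
- exact: var_ideal_var.
- rewrite mono_ideal_add1; last exact: meets_up.
  rewrite (eq_mono_ideal (U' := meets (v |: V))).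
    rewrite -[#|V|.+1]add1n -[1%N]/(true : nat) -nVv -cardsU1; apply: IHd.
    rewrite cardsU1 nVv; lia.
  move=> m; split=> [[[w Vw mw]|]|[w]].
  + by exists w; rewrite // inE Vw orbT.
  + by rewrite lep1mP => mv; exists v; rewrite // setU11.
  + by rewrite !inE => /orP[/eqP->|Vw] mw; [right; rewrite lep1mP | left; exists w].
Qed.

End MonomialIdeals.

Section StableIdeals.
Variables (K : fieldType) (N n k : nat) (grp : 'I_N -> 'I_n) (lev : 'I_N -> nat).
Hypothesis grp_lev_inj : forall v w, grp v = grp w -> lev v = lev w -> v = w.
Implicit Types (m u g : 'X_{1..N}) (v w : 'I_N) (i : 'I_n) (s : seq 'X_{1..N}).
Local Notation X := (fun v : 'I_N => 'X_v : {mpoly K[N]}).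
Local Notation monos s := (@mono_ideal K N (upset (fun g => g \in s))).

(** For x_{i,j}, [grp] gives the first index i and [lev] the position within the group. *)
Definition multideg u := forall i, (\sum_(v | grp v == i) u v = k)%N.
Definition stable s := forall u v w, u \in s -> u v != 0%N ->
  grp w = grp v -> (lev w < lev v)%N -> (u - U_(v) + U_(w))%MM \in s.
(** The set V_u: the variables that stability allows to replace a variable of [u]. *)
Definition lowset u : {set 'I_N} :=
  [set w | [exists v, [&& u v != 0%N, grp w == grp v & (lev w < lev v)%N]]].
Definition weight u := (\sum_v u v * lev v)%N.

Lemma mdeg_multideg u : multideg u -> mdeg u = (n * k)%N.
Proof.
move=> deg_u; rewrite mdegE (partition_big grp predT) //=.
by under eq_bigr => i _ do rewrite deg_u; rewrite sum_nat_const card_ord.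
Qed.

Lemma weightD u m : weight (u + m) = (weight u + weight m)%N.
Proof. by rewrite -big_split; apply: eq_bigr => v _; rewrite mnmDE mulnDl. Qed.

Lemma weight1 v : weight U_(v) = lev v.
Proof.
rewrite /weight (bigD1 v) //= big1 => [|w nwv]; first by rewrite mnm1E eqxx mul1n addn0.
by rewrite mnm1E eq_sym (negPf nwv).
Qed.

Lemma weight_move u v w : u v != 0%N -> (lev w < lev v)%N ->
  (weight (u - U_(v) + U_(w)) < weight u)%N.
Proof.
rewrite -lep1mP => /submK {2}<- lt_wv.
by rewrite !weightD !weight1 ltn_add2l.
Qed.

(** Read contrapositively: if g differs from [u] and is no heavier, it exceeds [u] at a variable of
    V_u. This puts g : u into the ideal (V_u). *)
Lemma weight_colon u g : multideg u -> multideg g -> (weight g <= weight u)%N ->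
  (forall v, v \in lowset u -> (g v <= u v)%N) -> g = u.
Proof.
move=> deg_u deg_g le_gu low.
pose T i := (\max_(v | (grp v == i) && (u v != 0)) lev v)%N.
have ltT v : (lev v < T (grp v))%N -> (g v <= u v)%N.
  move=> lt_vT; apply: low; rewrite inE; apply: contraLR lt_vT => /existsPn no.
  rewrite -leqNgt; apply/bigmax_leqP => w /andP[/eqP eq_w uw].
  by have := no w; rewrite uw eq_w eqxx /= -leqNgt.
have gtT v : (T (grp v) < lev v)%N -> u v = 0%N.
  move=> lt_Tv; apply/eqP; apply: contraLR lt_Tv => uv; rewrite -leqNgt.
  by apply: (@leq_bigmax_cond _ _ lev); rewrite eqxx.
(* A - B is (u v - g v)(T - lev v). It is nonnegative, since g <= u below level T and u = 0 above
   it. *)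
pose A v := (g v * lev v + u v * T (grp v))%N.
pose B v := (u v * lev v + g v * T (grp v))%N.
have le_BA v : (B v <= A v)%N.
  rewrite /A /B; have := ltT v; have := gtT v.
  by case: (ltngtP (lev v) (T (grp v))) => [lt _ /(_ isT) le|lt /(_ isT) -> _|-> _ _]; nia.
have sumT h : multideg h -> (\sum_v h v * T (grp v) = \sum_i k * T i)%N.
  move=> deg_h; rewrite (partition_big grp predT) //=; apply: eq_bigr => i _.
  rewrite -[in RHS](deg_h i) big_distrl; apply: eq_bigr => v /eqP <- //.
(* As [u] and [g] have equal multidegree, the terms with T agree in total and the sums compare the
   weights. Hence all the inequalities are equalities. *)
have eq_BA v : B v = A v.
  have [le_sum eq_sum] := leqif_sum (fun v (_ : predT v) => leqif_eq (le_BA v)).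
  have : (\sum_v B v == \sum_v A v)%N.
    rewrite eqn_leq le_sum /A /B !big_split /= !sumT //.
    by rewrite leq_add2r.
  by rewrite eq_sum => /forallP/(_ v)/eqP.
have eq_neT v : lev v != T (grp v) -> g v = u v.
  move=> nvT; have := eq_BA v; rewrite /A /B; have := ltT v; have := gtT v.
  by case: (ltngtP (lev v) (T (grp v))) nvT => [lt _ _ /(_ isT) le|lt _ /(_ isT) -> _|] //; nia.
(* The only variable of a group left is the one at level T, where the common degree [k] forces
   equality. *)
apply/mnmP => v; have [eq_vT|/eq_neT //] := eqVneq (lev v) (T (grp v)).
have := deg_g (grp v); rewrite -(deg_u (grp v)) (bigD1 v) //= [RHS](bigD1 v) //=.
rewrite [X in (_ + X)%N = _](eq_bigr u) => [/addIn //|w /andP[/eqP eq_wv nwv]].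
apply: eq_neT; apply: contra nwv => /eqP eq_wT; apply/eqP/grp_lev_inj => //.
by rewrite eq_wT eq_vT eq_wv.
Qed.

Lemma ex_max_seq (T : eqType) (f : T -> nat) (t : seq T) : t != [::] ->
  exists2 a, a \in t & forall b, b \in t -> (f b <= f a)%N.
Proof.
elim: t => // a [|b t] IHt _.
  by exists a; rewrite ?mem_head // => c; rewrite inE => /eqP->.
have [//|c tc maxc] := IHt; have [le_ac|lt_ca] := leqP (f a) (f c).
  by exists c => [|d]; rewrite inE ?tc ?orbT // => /orP[/eqP->|/maxc].
exists a => [|d]; first exact: mem_head.
by rewrite inE => /orP[/eqP->|/maxc /leq_trans ->] //; apply: ltnW.
Qed.

(* Removing a monomial [u] of maximal weight leaves a stable set, and the
   colon ideal by [u] is generated by the variables in [lowset u]: the ideal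
   has linear quotients. *)
Theorem stable_koszul_vanish s q : stable s -> (forall u, u \in s -> multideg u) ->
  (forall u, u \in s -> (#|lowset u| <= q)%N) -> koszul_vanish X (monos s) q.+1.
Proof.
have [d] := ubnP (size s); elim: d s => // d IHd s lt_sd stab deg low.
have [s0|s_n0] := eqVneq s [::].
  rewrite (eq_mono_ideal K (U' := meets set0)).
    by apply: (koszul_vanishW (leq0n _)); rewrite -(cards0 'I_N); apply: koszul_vanish_vars.
  by move=> m; split=> [[g]|[v]]; rewrite ?s0 ?inE.
have [u su maxu] := ex_max_seq weight s_n0.
pose s' := [seq g <- s | g != u].
have s's g : g \in s' -> g \in s by rewrite mem_filter => /andP[].
have s'P g : g \in s -> (g = u) \/ (g \in s').
  by have [->|ngu] := eqVneq g u; [left | rewrite mem_filter ngu; right].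
(* A move strictly lowers the weight, so it never produces [u], which has maximal weight. *)
have stab' g v w : g \in s -> g v != 0%N -> grp w = grp v -> (lev w < lev v)%N ->
    (g - U_(v) + U_(w))%MM \in s'.
  move=> sg gv eq_wv lt_wv; rewrite mem_filter stab // andbT.
  apply/eqP => eq_u; have := weight_move gv lt_wv.
  by rewrite eq_u ltnNge maxu.
have -> : monos s = ideal_add1 (monos s') 'X_[u].
  rewrite mono_ideal_add1; last exact: upset_up.
  apply: eq_mono_ideal => m; split=> [[g /s'P[->|s'g] le_gm]|[[g /s's sg le_gm]|le_um]].
  - by right.
  - by left; exists g.
  - by exists g.
  - by exists u.
have s'_id : is_ideal (monos s') by apply/mono_ideal_ideal/upset_up.
apply: koszul_vanish_cone => //.
  apply: IHd => [|g v w /s's sg|g /s's|g /s's].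
  - rewrite -ltnS (leq_trans _ lt_sd) // ltnS -(count_predC (pred1 u) s) size_filter.
    by rewrite -[X in (X < _)%N]add0n ltn_add2r -has_count has_pred1.
  - exact: stab'.
  - exact: deg.
  - exact: low.
rewrite mono_ideal_colon (eq_mono_ideal K (U' := meets (lowset u))).
  by apply: (koszul_vanishW (low u su)); apply: koszul_vanish_vars.
move=> m; split=> [[g s'g le_g]|[w]].
  (* If no variable of V_u divides [m], then g | u m gives g <= u on V_u, and [weight_colon] forces
     g = u. *)
  apply: contrapT => nomeet; have := s'g; rewrite mem_filter => /andP[/eqP + sg].
  apply; apply: weight_colon; [exact: deg | exact: deg | exact: maxu |] => v low_v.
  have := mnm_lepP le_g v; rewrite mnmDE.
  suff /eqP -> : m v == 0%N by rewrite addn0.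
  by apply/negPn/negP => mv; apply: nomeet; exists v.
rewrite inE => /existsP[v /and3P[uv /eqP eq_wv lt_wv]] mw.
exists (u - U_(v) + U_(w))%MM; first exact: stab'.
apply/mnm_lepP => t; rewrite !mnmDE mnmBE leq_add ?leq_subr //.
by move: t; apply/mnm_lepP; rewrite lep1mP.
Qed.

End StableIdeals.

(** * Nonvanishing of Koszul homology *)

Section NonvanishingCycle.
Variables (K : fieldType) (N n : nat) (grp : 'I_N -> 'I_n) (lev : 'I_N -> nat).
Variable top : 'I_n -> 'I_N.
Hypothesis grp_top : forall i, grp (top i) = i.
Implicit Types (u g : 'X_{1..N}) (v w : 'I_N) (i : 'I_n) (l : seq 'I_n) (t : {set 'I_N}).
Local Notation X := (fun v : 'I_N => 'X_v : {mpoly K[N]}).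

Definition below_top : {set 'I_N} := [set v | (lev v <= lev (top (grp v)))%N].
Definition group_var i v : {mpoly K[N]} := if grp v == i then 'X_v else 0.

(* Up to sign, the product of the boundaries of the top forms of the groups in
   [l] and of the top forms of the other groups. *)
Definition group_cycle l : {set 'I_N} -> {mpoly K[N]} :=
  foldr (fun i z => contract (group_var i) z) (fun t => (t == below_top)%:R) l.

(** These products of one variable from each group of [l], at or below the top, bound the exponents
    in the coefficients of [group_cycle]. *)
Fixpoint group_monomial l g : Prop :=
  if l is i :: l' then exists v g', [/\ v \in below_top, grp v = i,
    group_monomial l' g' & g = (U_(v) + g')%MM]
  else g = 0%MM.

Definition tops l : {set 'I_N} := [set v | (v == top (grp v)) && (grp v \in l)].

Lemma card_tops l : uniq l -> #|tops l| = size l.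
Proof.
move=> uniq_l; rewrite -(card_uniqP uniq_l) -(card_imset (mem l) (can_inj grp_top)).
apply: eq_card => v; rewrite inE; apply/andP/imsetP => [[/eqP eq_v lv]|[i li ->]].
  by exists (grp v).
by rewrite grp_top eqxx.
Qed.

Lemma group_cycle_supp l c : (#|below_top| = size l + c)%N -> supp_card c (group_cycle l).
Proof.
elim: l c => [|i l IHl] c /= eq_c; last by apply: contract_supp; apply: IHl; rewrite addnS.
by move=> t nt; case: eqP => // eq_t; case: nt; rewrite eq_t eq_c.
Qed.

Lemma group_cycle_sub l t : ~~ (t \subset below_top) -> group_cycle l t = 0.
Proof.
elim: l t => [|i l IHl] t nt /=; first by case: eqP nt => // ->; rewrite subxx.
apply: big1 => v _; rewrite /contract1; case: ifP => _; rewrite ?mulr0 // IHl ?mulr0 //.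
by apply: contra nt; apply: subset_trans; apply: subsetUr.
Qed.

Lemma group_cycle_mono l t : mono_ideal (upset (group_monomial l)) (group_cycle l t).
Proof.
elim: l t => [|i l IHl] t /=.
  have U_id := mono_ideal_ideal K (@upset_up _ (group_monomial [::])).
  case: eqP => _; last exact: ideal0.
  by rewrite -mpolyX0; apply/mono_idealX; exists 0%MM => //; apply: lepm_refl.
have U_id := mono_ideal_ideal K (@upset_up _ (group_monomial (i :: l))).
apply: ideal_sum => // v _; rewrite /contract1; case: ifP => _.
  by rewrite mulr0; apply: ideal0.
rewrite /group_var; case: eqP => [eq_i|_]; last by rewrite mul0r; apply: ideal0.
have [sub|/group_cycle_sub ->] := boolP (v |: t \subset below_top); last first.
  by rewrite !mulr0; apply: ideal0.
have bv : v \in below_top by apply: (subsetP sub); apply: setU11.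
rewrite mulrCA; apply: (idealMl _ U_id) => m.
rewrite mulrC (perm_mem (msuppMX _ _)) => /mapP[m' /IHl[g lg le_gm'] ->].
exists (U_(v) + g)%MM; first by exists v, g.
by apply/mnm_lepP => w; rewrite !mnmDE leq_add2l; apply/mnm_lepP.
Qed.

(** Within group [i], only [top i] belongs to [below_top] and is missing from the set, so a single
    term survives each contraction. *)
Lemma group_cycle_coef l : uniq l -> exists e : nat,
  group_cycle l (below_top :\: tops l) = (-1) ^+ e * 'X_[(\sum_(i <- l) U_(top i))%MM].
Proof.
elim: l => [_|i l IHl /andP[nli uniq_l]].
  exists 0%N; rewrite /= (_ : tops [::] = set0) ?setD0 ?eqxx ?big_nil ?mpolyX0 ?mul1r //.
  by apply/setP => v; rewrite !inE andbF.
have [e eq_e] := IHl uniq_l.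
have top_W : top i \in below_top by rewrite inE grp_top.
have eq_set : top i |: (below_top :\: tops (i :: l)) = below_top :\: tops l.
  apply/setP => v; rewrite !inE.
  have [->|nvt] := eqVneq v (top i); first by rewrite grp_top (negPf nli) andbF leqnn.
  by have [->|] := eqVneq (grp v) i; rewrite ?(negPf nvt) ?inE.
have ntop : top i \notin below_top :\: tops (i :: l).
  by rewrite !inE grp_top !eqxx.
rewrite big_cons /= /contract (bigD1 (top i)) //= big1 => [|v nvt].
  rewrite addr0 /contract1 (negPf ntop) eq_set eq_e /group_var grp_top eqxx /ext_sign mpolyXD.
  set a := #|_|; exists (a + e)%N; rewrite exprD; ring.
rewrite /contract1; case: ifPn => nv; first by rewrite mulr0.
rewrite /group_var; case: eqP => eq_i; last by rewrite mul0r.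
rewrite group_cycle_sub ?mulr0 //; apply/subsetP => /(_ v (setU11 _ _)) bv.
by move: nv; rewrite in_setD bv andbT inE eq_i (negPf nvt).
Qed.

(** Anticommute the contraction inward until it meets its own copy, where it squares to zero. *)
Lemma contract_group_cycle i l t : i \in l -> contract (group_var i) (group_cycle l) t = 0.
Proof.
elim: l t => // j l IHl t; rewrite inE /=; have [->|_ /= li] := eqVneq i j.
  by rewrite contract_contract.
rewrite contractC (_ : contract (group_var i) _ = fun=> 0); last by apply/funext => w; apply: IHl.
by rewrite /contract big1 ?oppr0 // => v _; rewrite /contract1; case: ifP; rewrite !mulr0.
Qed.

Lemma contract_vars (z : {set 'I_N} -> {mpoly K[N]}) t :
  contract X z t = \sum_i contract (group_var i) z t.
Proof.
rewrite /contract exchange_big; apply: eq_bigr => v _ /=.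
rewrite -mulr_suml (bigD1 (grp v)) //= /group_var eqxx big1 ?addr0 // => i.
by rewrite eq_sym => /negPf->.
Qed.

(** The Koszul differential is the sum of the group differentials. Those of [l] kill the cycle, so
    only the omitted group [i] contributes. *)
Lemma contract_vars_cycle i l t : perm_eq (i :: l) (enum 'I_n) ->
  contract X (group_cycle l) t = group_cycle (i :: l) t.
Proof.
move=> perm_il; rewrite contract_vars (bigD1 i) //= big1 ?addr0 // => j nji.
apply: contract_group_cycle; have : j \in i :: l by rewrite (perm_mem perm_il) mem_enum.
by rewrite inE (negPf nji).
Qed.

End NonvanishingCycle.

Section StableNonvanishing.
Variables (K : fieldType) (N n k : nat) (grp : 'I_N -> 'I_n) (lev : 'I_N -> nat).
Hypothesis grp_lev_inj : forall v w, grp v = grp w -> lev v = lev w -> v = w.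
Hypotheses (n_gt0 : (0 < n)%N) (k_gt0 : (0 < k)%N).
Implicit Types (u g : 'X_{1..N}) (v w : 'I_N) (s : seq 'X_{1..N}).
Local Notation X := (fun v : 'I_N => 'X_v : {mpoly K[N]}).
Local Notation monos s := (@mono_ideal K N (upset (fun g => g \in s))).

Lemma ex_top u : multideg k grp u -> exists top : 'I_n -> 'I_N, forall i,
  [/\ grp (top i) = i, u (top i) != 0%N &
      forall v, grp v = i -> u v != 0%N -> (lev v <= lev (top i))%N].
Proof.
move=> deg_u; suff /choice[top topP] : forall i, exists w, [/\ grp w = i, u w != 0%N &
    forall v, grp v = i -> u v != 0%N -> (lev v <= lev w)%N] by exists top.
move=> i; have [w /andP[/eqP gw uw]] : exists w, (grp w == i) && (u w != 0%N).
  apply: contrapT => no; move: (deg_u i); rewrite big1 => [eq_k|v /eqP gv].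
    by move: k_gt0; rewrite -eq_k.
  by apply/eqP/negPn/negP => uv; apply: no; exists v; rewrite gv eqxx.
pose P v := (grp v == i) && (u v != 0%N).
have Pw : P w by rewrite /P gw eqxx.
case: (@arg_maxnP _ w P lev Pw) => t /andP[/eqP gt ut] maxt.
by exists t; split=> // v gv uv; apply: maxt; rewrite /P gv eqxx.
Qed.

(** Stability replaces the tops one after another by variables at or below them. This makes the
    boundary of the cycle vanish modulo the ideal. *)
Lemma group_monomial_stable top s r l g : stable grp lev s ->
  (forall i, grp (top i) = i) ->
  (r + (\sum_(i <- l) U_(top i))%MM)%MM \in s ->
  group_monomial grp lev top l g -> (r + g)%MM \in s.
Proof.
move=> stab grp_top; elim: l r g => [|i l IHl] r g /=.
  by rewrite big_nil => sr ->.
rewrite big_cons => sr [v [g' [bv gv lg' ->]]].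
rewrite addmA; apply: IHl lg'; move: bv; rewrite inE gv leq_eqVlt => /orP[/eqP eq_lev|lt_v].
  by rewrite (grp_lev_inj (w := top i) _ eq_lev) ?grp_top // -addmA.
have := stab _ (top i) v sr; rewrite grp_top gv => /(_ _ (erefl _) lt_v).
set S := \big[_/_]_(_ <- _) _.
have -> : (r + (U_(top i) + S) - U_(top i) + U_(v) = r + U_(v) + S)%MM.
  by apply/mnmP => w; rewrite !mnmDE mnmBE !mnmDE; lia.
by apply; rewrite !mnmDE mnm1E eqxx; lia.
Qed.

(* The boundary of the cycle has the coefficient [u] up to sign, whose degree
   n * k is too small for the boundary of an element with coefficients in the ideal. *)
Theorem stable_koszul_nonvanish s u : stable grp lev s ->
  (forall g, g \in s -> multideg k grp g) -> u \in s ->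
  ~ koszul_vanish X (monos s) #|lowset grp lev u|.
Proof.
move=> stab deg su van.
have [top topP] := ex_top (deg u su).
have grp_top i : grp (top i) = i by case: (topP i).
pose W := below_top grp lev top.
(* [i0] is the one group whose top form is kept without taking its boundary. *)
have [i0 [l il]] : exists i0 l, enum 'I_n = i0 :: l.
  case eq_e: (enum 'I_n) => [|i l]; last by exists i, l.
  by have := size_enum_ord n; rewrite eq_e /= => n0; move: n_gt0; rewrite -n0.
have uniq_il : uniq (i0 :: l) by rewrite -il enum_uniq.
have W_tops : W :\: tops grp top (i0 :: l) = lowset grp lev u.
  apply/setP => v; rewrite -il !inE mem_enum andbT.
  have [_ ut maxt] := topP (grp v).
  apply/andP/existsP => [[nvt le_vt]|[w /and3P[uw /eqP eq_wv lt_vw]]].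
    exists (top (grp v)); rewrite ut grp_top eqxx ltn_neqAle le_vt andbT.
    by apply: contra nvt => /eqP/(grp_lev_inj (esym (grp_top _))) <-.
  have lt_v := leq_trans lt_vw (maxt w (esym eq_wv) uw).
  by rewrite (ltnW lt_v); split=> //; apply: contraL lt_v => /eqP <-; rewrite ltnn.
(* [W] is the disjoint union of V_u and the n tops; contracting once for each of the n - 1 groups in
   [l] leaves degree |V_u| + 1. *)
have card_W : #|W| = (size l + #|lowset grp lev u|.+1)%N.
  rewrite -(cardsID (tops grp top (i0 :: l)) W) W_tops (setIidPr _).
    by rewrite card_tops //= addSnnS.
  by apply/subsetP => v; rewrite !inE => /andP[/eqP<-].
pose S := (\sum_(i <- i0 :: l) U_(top i))%MM.
have le_Su : (S <= u)%MM.
  apply/mnm_lepP => v; rewrite /S mnm_sumE -il big_enum /=.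
  rewrite (bigD1 (grp v)) //= big1 => [|i ni]; last first.
    by rewrite mnm1E; case: eqP => // eq_v; rewrite -eq_v grp_top eqxx in ni.
  have [_ ut _] := topP (grp v); rewrite mnm1E addn0.
  by case: eqP => // {1}<-; rewrite lt0n.
pose r := (u - S)%MM.
have def_u : u = (r + S)%MM by rewrite submK.
have J_id : is_ideal (monos s) by apply/mono_ideal_ideal/upset_up.
pose z t := 'X_[r] * group_cycle K grp lev top l t : {mpoly K[N]}.
have Dz t : contract X z t = 'X_[r] * group_cycle K grp lev top (i0 :: l) t.
  by rewrite contractZ (contract_vars_cycle K grp lev top (i := i0)) // il.
have [t|t|y yi yP] := van #|lowset grp lev u|.+1 z (ltnSn _).
- by move=> nt; rewrite /z (group_cycle_supp K card_W) ?mulr0.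
- rewrite Dz => m; rewrite mulrC (perm_mem (msuppMX _ _)) => /mapP[m' + ->].
  case/group_cycle_mono => g lg le_g; exists (r + g)%MM.
    by apply: group_monomial_stable lg => //; rewrite -def_u.
  by apply/mnm_lepP => v; rewrite !mnmDE leq_add2l; apply/mnm_lepP.
have up_deg : mono_up (fun m : 'X_{1..N} => (n * k < mdeg m)%N).
  by move=> m m' lt_m; rewrite mdegD ltn_addr.
have D_id := mono_ideal_ideal K up_deg.
(* Since d d y = 0, d z is d (z - d y). The coefficients of z - d y lie in an ideal generated in
   degree n k, and d multiplies them by variables. *)
have : mono_ideal (fun m => (n * k < mdeg m)%N) (contract X z (lowset grp lev u)).
  rewrite -[contract X z _]subr0 -(contract_contract X y (lowset grp lev u)) -contractB.
  apply: ideal_sum => // v _; rewrite mulrC => m.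
  rewrite (perm_mem (msuppMX _ _)) => /mapP[m' + ->].
  have /[apply] : monos s (contract1 v (fun t => z t - contract X y t) (lowset grp lev u)).
    by rewrite /contract1; case: ifP => _; [apply: (ideal0 J_id) | apply: (idealMl _ J_id)].
  case=> g sg /mnm_lepP le_g; rewrite mdegD mdeg1 add1n ltnS -(mdeg_multideg (deg g sg)).
  by rewrite !mdegE leq_sum.
have [e] := group_cycle_coef K lev grp_top uniq_il.
rewrite Dz W_tops => ->; rewrite mulrCA -mpolyXD -def_u => D_u.
have /mono_idealX : mono_ideal (fun m => (n * k < mdeg m)%N) 'X_[K, u].
  by rewrite -['X_[u]](signrMK e); apply: (idealMl _ D_id).
by rewrite (mdeg_multideg (deg u su)) ltnn.
Qed.

End StableNonvanishing.

(** * Depth of quotients by stable ideals *)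

Section StableDepth.
Variables (K : fieldType) (N n k : nat) (grp : 'I_N -> 'I_n) (lev : 'I_N -> nat).
Hypothesis grp_lev_inj : forall v w, grp v = grp w -> lev v = lev w -> v = w.
Hypotheses (n_gt0 : (0 < n)%N) (k_gt0 : (0 < k)%N).
Implicit Types (u g : 'X_{1..N}) (s : seq 'X_{1..N}).
Local Notation X := (fun v : 'I_N => 'X_v : {mpoly K[N]}).
Local Notation monos s := (@mono_ideal K N (upset (fun g => g \in s))).

Lemma graded_max_idealE : @graded_max_ideal K N = var_ideal X.
Proof.
apply/funext => p; apply/propext; split.
  by apply=> [|_ [v ->]]; [apply: var_ideal_ideal | apply: (var_ideal_var X)].
case=> g ->; have m_id := ideal_gen_ideal (fun p : {mpoly K[N]} => exists i, p = 'X_i).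
apply: (ideal_sum _ m_id) => v _; rewrite mulrC; apply: (idealMl _ m_id).
by apply: ideal_gen_incl; exists v.
Qed.

Lemma mono_ideal_sub_vars U p : ~ U 0%MM -> @mono_ideal K N U p -> var_ideal X p.
Proof.
move=> nU0; apply: mono_ideal_sub => [|m Um]; first exact: var_ideal_ideal.
have [v mv] : exists v, m v != 0%N.
  apply: contrapT => no; apply: nU0; suff <- : m = 0%MM by [].
  apply/mnmP => v; rewrite mnm0E; apply/eqP/negPn/negP => mv.
  by apply: no; exists v.
rewrite -lep1mP in mv; rewrite -(submK mv) mpolyXD.
apply: idealMl; [exact: var_ideal_ideal | exact: (var_ideal_var X)].
Qed.

Lemma var_ideal_proper : ~ var_ideal X 1.
Proof.
case=> g /(congr1 (mcoeff 0%MM)) /eqP; rewrite mcoeff1 eqxx raddf_sum big1 ?oner_eq0 //.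
move=> v _ /=; rewrite mulrC; apply/eqP; rewrite mcoeff_eq0 (perm_mem (msuppMX _ _)).
apply/mapP => -[m _ /(congr1 mdeg)/eqP].
by rewrite mdeg0 mdegD mdeg1.
Qed.

(** With q = |V_u| maximal, vanishing above q + 1 yields a regular sequence of length N - q - 1. A
    longer one would annihilate the nonzero homology in degree q + 1. *)
Theorem stable_depth s d u : stable grp lev s ->
  (forall g, g \in s -> multideg k grp g) -> u \in s ->
  (forall g, g \in s -> (#|lowset grp lev g| <= #|lowset grp lev u|)%N) ->
  (d + #|lowset grp lev u|.+1 = N)%N ->
  has_quot_depth (@graded_max_ideal K N) (monos s) d.
Proof.
move=> stab deg su maxu eq_d; rewrite graded_max_idealE.
have J_id : is_ideal (monos s) by apply/mono_ideal_ideal/upset_up.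
split=> [|l [t [size_t tM reg_t]]].
  have van := @stable_koszul_vanish K _ _ _ _ _ grp_lev_inj _ _ stab deg maxu.
  apply: (ex_regular_seq (@mpoly_noetherian _ _) var_ideal_proper J_id _ van).
    move=> p; apply: mono_ideal_sub_vars => -[g sg /mnm_lepP le_g0].
    have : mdeg g = 0%N.
      by rewrite mdegE big1 // => v _; have := le_g0 v; rewrite mnm0E leqn0 => /eqP.
    by rewrite (mdeg_multideg (deg g sg)) => /eqP; rewrite muln_eq0 !gtn_eqF.
  by rewrite addnC eq_d.
rewrite leqNgt; apply/negP => lt_dl.
apply: (@stable_koszul_nonvanish K _ _ _ _ _ grp_lev_inj n_gt0 k_gt0 _ _ stab deg su).
apply: (regular_seq_koszul_vanish J_id tM reg_t).
by rewrite size_t; lia.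
Qed.

End StableDepth.

(** * Pure powers in zero-dimensional monomial ideals, and products of monomial ideals *)

Lemma dim0_pure_power (K : fieldType) n (I : {mpoly K[n]} -> Prop) (i : 'I_n) :
  is_monomial_ideal I -> has_quot_dim I 0 -> exists c, I ('X_i ^+ c).
Proof.
move=> [G IG] [_ dim0]; apply: contrapT => nopow.
(* Set all variables except x_i to zero. Without a pure power of x_i every generator of [I] maps to
   0, so the kernel, strictly inside the ideal of the origin, gives a chain of length 1. *)
pose h (j : 'I_n) : {poly K} := if j == i then 'X else 0.
pose phi : {rmorphism {mpoly K[n]} -> {poly K}} := mmap (@polyC K) h.
have phiX m : phi 'X_[m] = \prod_j h j ^+ m j by rewrite /phi /= mmapX.
have phiXi : phi 'X_i = 'X by rewrite /phi /= mmapX mmap1U /h eqxx.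
pose P0 p := phi p = 0; pose P1 p := (phi p).[0] = 0.
have P0_id : is_ideal P0.
  rewrite /P0; split=> [|p q p0 q0|a p p0]; first exact: rmorph0.
    by rewrite rmorphD p0 q0 addr0.
  by rewrite rmorphM p0 mulr0.
have P1_id : is_ideal P1.
  rewrite /P1; split=> [|p q p0 q0|a p p0]; first by rewrite rmorph0 horner0.
    by rewrite rmorphD hornerD p0 q0 addr0.
  by rewrite rmorphM hornerM p0 mulr0.
have IP0 p : I p -> P0 p.
  move=> /IG; apply=> // _ [m [Gm ->]]; rewrite /P0 phiX.
  have [[j nji mj]|no] := pselect (exists2 j, j != i & m j != 0%N).
    by rewrite (bigD1 j) //= /h (negPf nji) expr0n (negPf mj) mul0r.
  case: nopow; exists (m i); rewrite mpolyXn; apply/IG; apply: ideal_gen_incl.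
  exists m; split=> //; congr 'X_[_]; apply/mnmP => j; rewrite mulmnE mnm1E.
  have [<-|nij] := eqVneq i j; first by rewrite mul1n.
  rewrite mul0n; apply/esym/eqP/negPn/negP => mj; apply: no.
  by exists j; rewrite // eq_sym.
suff : (1 <= 0)%N by [].
apply: dim0; exists (fun l => if l == 0%N then P0 else P1); split=> [l _|l].
  case: eqP => _; split.
  - split=> // [|a b]; first by rewrite /P0 rmorph1; apply/eqP/oner_neq0.
    by rewrite /P0 rmorphM => /eqP; rewrite mulf_eq0 => /orP[]/eqP; [left|right].
  - exact: IP0.
  - split=> // [|a b]; first by rewrite /P1 rmorph1 hornerC; apply/eqP/oner_neq0.
    by rewrite /P1 rmorphM hornerM => /eqP; rewrite mulf_eq0 => /orP[]/eqP; [left|right].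
  - by move=> p /IP0; rewrite /P0 /P1 => ->; rewrite horner0.
rewrite ltnS leqn0 => /eqP-> /=; split=> [p|].
  by rewrite /P0 /P1 => ->; rewrite horner0.
exists 'X_i; rewrite /P0 /P1 phiXi hornerX; split=> //.
by apply/eqP; rewrite polyX_eq0.
Qed.

Lemma ideal_mul_mono (K : fieldType) N (G H : 'X_{1..N} -> Prop) :
  ideal_mul (@mono_ideal K N (upset G)) (mono_ideal (upset H)) =
  mono_ideal (upset (fun m => exists g h, [/\ G g, H h & m = (g + h)%MM])).
Proof.
set GH := fun m => _; have GH_id := mono_ideal_ideal K (@upset_up _ GH).
apply/funext => p; apply/propext; split.
  apply=> // _ [a [b [Ga Hb ->]]] m.
  move=> /msuppM_le/allpairsP[[m1 m2] /= [/Ga[g Gg le_g] /Hb[h Hh le_h] ->]].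
  exists (g + h)%MM; first by exists g, h.
  by apply/mnm_lepP => v; rewrite !mnmDE leq_add //; apply/mnm_lepP.
rewrite /ideal_mul; set A := fun q => _; have A_id := ideal_gen_ideal A.
apply: mono_ideal_sub => // m [_ [g [h [Gg Hh ->]]] /submK <-].
rewrite mpolyXD; apply: (idealMl _ A_id); apply: ideal_gen_incl.
exists 'X_[g], 'X_[h]; split; last by rewrite mpolyXD.
  by apply/mono_idealX; exists g => //; apply: lepm_refl.
by apply/mono_idealX; exists h => //; apply: lepm_refl.
Qed.

(** * The ideal L(I) *)

Section LIdeal.
Variables (K : fieldType) (n : nat) (I : {mpoly K[n]} -> Prop) (b : 'I_n -> nat).
Hypotheses (I_id : is_ideal I) (n_gt0 : (0 < n)%N) (I_proper : ~ I 1).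
Hypothesis b_least : forall i, is_least (fun c => I ('X_i ^+ c)) (b i).
Local Notation N := (pvar_count b).
Local Notation A := (mon_compl I).
Implicit Types (a : 'X_{1..n}) (v w : 'I_N) (i : 'I_n).

Definition pgrp v : 'I_n := tag (enum_val v).
Definition plev v : nat := tagged (enum_val v).
Definition pidx i (j : 'I_(b i)) : 'I_N := enum_rank (Tagged (fun i => 'I_(b i)) j).
(** The exponent vector of the generator of L(I) attached to x^a, second indices being counted from
    0. *)
Definition lgen a : 'X_{1..N} := [multinom (plev v == a (pgrp v) : nat) | v < N].
Definition lpow_gen k (g : 'X_{1..N}) := exists f : 'I_k -> 'X_{1..n},
  (forall j, A (f j)) /\ g = (\sum_(j < k) lgen (f j))%MM.

Lemma pgrp_lev_inj v w : pgrp v = pgrp w -> plev v = plev w -> v = w.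
Proof.
rewrite /pgrp /plev => eq_g eq_l; apply: enum_val_inj.
case: (enum_val v) (enum_val w) eq_g eq_l => i j [i' j'] /= eq_i.
by case: _ / eq_i j' => j' /val_inj ->.
Qed.

Lemma pgrp_pidx i j : pgrp (@pidx i j) = i. Proof. by rewrite /pgrp enum_rankK. Qed.
Lemma plev_pidx i j : plev (@pidx i j) = j. Proof. by rewrite /plev enum_rankK. Qed.

Lemma compl_down a a' : (a' <= a)%MM -> A a -> A a'.
Proof.
by move=> /submK <- nIa Ia'; apply: nIa; rewrite mpolyXD; apply: idealMl.
Qed.

Lemma compl_lt a i : A a -> (a i < b i)%N.
Proof.
move=> Aa; rewrite ltnNge; apply/negP => le_ba.
have : A (U_(i) *+ b i)%MM.
  apply: compl_down Aa; apply/mnm_lepP => j; rewrite mulmnE mnm1E.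
  by case: eqP => [<-|_]; rewrite ?mul1n ?mul0n.
by apply; rewrite -mpolyXn; case: (b_least i).
Qed.

Lemma b_gt0 i : (0 < b i)%N.
Proof.
rewrite lt0n; apply/eqP => b0; apply: I_proper.
by have [+ _] := b_least i; rewrite b0 expr0.
Qed.

Lemma compl_pred_power i : A (U_(i) *+ (b i).-1)%MM.
Proof.
rewrite /mon_compl -mpolyXn => /(b_least i).2.
by rewrite leqNgt prednK ?leqnn ?b_gt0.
Qed.

Lemma sum_lgen k (f : 'I_k -> 'X_{1..n}) v :
  ((\sum_(j < k) lgen (f j))%MM v = \sum_(j < k) (plev v == f j (pgrp v)))%N.
Proof. by rewrite mnm_sumE; apply: eq_bigr => j _; rewrite mnmE. Qed.

Lemma sum_lgen_neq0 k (f : 'I_k -> 'X_{1..n}) v :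
  (\sum_(j < k) lgen (f j))%MM v != 0%N -> exists j, plev v = f j (pgrp v).
Proof.
rewrite sum_lgen => nz; apply: contrapT => no; move: nz.
rewrite big1 // => j _; case: eqP => // eq_j; case: no; by exists j.
Qed.

Lemma L_idealE : @L_ideal K n I b =
  mono_ideal (upset (fun g => exists2 a, A a & g = lgen a)).
Proof.
rewrite -mono_ideal_gen /L_ideal; congr ideal_gen; apply/funext => p; apply/propext.
have prodE a (lt_ab : forall i, (a i < b i)%N) :
    \prod_(i < n) pvar K (Ordinal (lt_ab i)) = 'X_[lgen a].
  rewrite /pvar mprodXE; congr 'X_[_]; apply/mnmP => v.
  rewrite mnm_sumE mnmE (bigD1 (pgrp v)) //= big1 ?addn0 => [|i nvi].
    rewrite mnm1E -/(pidx _); congr nat_of_bool; apply/eqP/eqP => [<-|eq_v].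
      by rewrite plev_pidx pgrp_pidx.
    by apply: pgrp_lev_inj; rewrite ?plev_pidx ?pgrp_pidx.
  rewrite mnm1E -/(pidx _); case: eqP => // eq_v.
  by move: nvi; rewrite -eq_v pgrp_pidx eqxx.
split=> [[a [lt_ab [Aa ->]]]|[_ [[a Aa ->] ->]]].
  by exists (lgen a); rewrite prodE; split=> //; exists a.
have lt_ab i := compl_lt i Aa.
by exists a, lt_ab; rewrite prodE.
Qed.

Lemma L_powE k : ideal_pow (@L_ideal K n I b) k = mono_ideal (upset (lpow_gen k)).
Proof.
elim: k => [|k IHk] /=.
  apply/funext => p; apply/propext; split=> // _ m _; exists 0%MM; last first.
    by apply/mnm_lepP => v; rewrite mnm0E.
  by exists (fun=> 0%MM); split=> [[]//|]; rewrite big_ord0.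
rewrite IHk L_idealE ideal_mul_mono; congr (mono_ideal (upset _)).
apply/funext => g; apply/propext; split.
  case=> _ [_ [[a Aa ->] [f [Af ->]] ->]].
  exists (fun j => if unlift ord0 j is Some j' then f j' else a); split=> [j|].
    by case: unliftP => [j'|] _.
  rewrite big_ord_recl unlift_none; congr (_ + _)%MM.
  by apply: eq_bigr => j _; rewrite liftK.
case=> f [Af ->]; rewrite big_ord_recl.
exists (lgen (f ord0)), (\sum_(j < k) lgen (f (lift ord0 j)))%MM; split=> //.
  by exists (f ord0).
by exists (fun j => f (lift ord0 j)).
Qed.

Lemma lpow_gen_multideg k g : lpow_gen k g -> multideg k pgrp g.
Proof.
case=> f [Af ->] i; under eq_bigr => v _ do rewrite sum_lgen.
rewrite exchange_big /= -[RHS]card_ord -sum1_card; apply: eq_bigr => j _.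
have lt_fb := compl_lt i (Af j).
rewrite (bigD1 (pidx (Ordinal lt_fb))) ?pgrp_pidx //= plev_pidx eqxx big1 // => v.
case/andP=> /eqP eq_i nv; apply/eqP; rewrite eqb0; apply: contra nv => /eqP eq_l.
by apply/eqP/pgrp_lev_inj; rewrite ?plev_pidx ?pgrp_pidx // eq_l eq_i.
Qed.

(** The variable [v] comes from some factor u_j. Lowering the corresponding exponent of u_j gives a
    divisor of it, which is still outside [I]. *)
Lemma lpow_gen_stable k u v w : lpow_gen k u -> u v != 0%N ->
  pgrp w = pgrp v -> (plev w < plev v)%N -> lpow_gen k (u - U_(v) + U_(w))%MM.
Proof.
case=> f [Af ->] nz eq_g lt_wv; have [j eq_j] := sum_lgen_neq0 nz.
pose a := [multinom if i == pgrp v then plev w else f j i | i < n].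
exists (fun j' => if j' == j then a else f j'); split=> [j'|].
  case: eqP => // _; apply: (compl_down _ (Af j)); apply/mnm_lepP => i.
  by rewrite mnmE; case: eqP => [->|//]; rewrite -eq_j ltnW.
apply/mnmP => x; rewrite mnmDE mnmBE !sum_lgen !mnm1E (bigD1 j) //= [RHS](bigD1 j) //= eqxx.
rewrite [in RHS](eq_bigr (fun j' => nat_of_bool (plev x == f j' (pgrp x)))); last first.
  by move=> j' /negPf->.
rewrite mnmE; have [eq_x|neq_x] := eqVneq (pgrp x) (pgrp v).
  have -> : (plev x == f j (pgrp x)) = (v == x).
    by rewrite eq_x -eq_j; apply/eqP/eqP => [?|->//]; apply: pgrp_lev_inj.
  have -> : (plev x == plev w) = (w == x).
    by apply/eqP/eqP => [?|->//]; apply: pgrp_lev_inj => //; rewrite eq_g.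
  lia.
have -> : (v == x) = false by apply: contraNF neq_x => /eqP->.
have -> : (w == x) = false by apply: contraNF neq_x => /eqP <-; apply/eqP.
by rewrite subn0 addn0.
Qed.

Lemma mlcm_bigE k (f : 'I_k -> 'X_{1..n}) i :
  (\big[@mlcm n/0%MM]_(j < k) f j) i = (\max_(j < k) f j i)%N.
Proof.
by apply: (big_morph (fun m : 'X_{1..n} => m i)) => [m m'|]; rewrite mnmE.
Qed.

Lemma lcm_le k (f : 'I_k -> 'X_{1..n}) i : (forall j, A (f j)) ->
  ((\big[@mlcm n/0%MM]_(j < k) f j) i <= (b i).-1)%N.
Proof.
move=> Af; rewrite mlcm_bigE; apply/bigmax_leqP => j _.
by rewrite -ltnS prednK ?b_gt0 // compl_lt.
Qed.

Lemma sum_pvar (F : 'I_n -> nat -> nat) :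
  (\sum_v F (pgrp v) (plev v) = \sum_i \sum_(j < b i) F i j)%N.
Proof.
rewrite sig_big_dep [RHS](reindex (fun v : 'I_N => enum_val v)) /=; last exact/onW_bij/enum_val_bij.
by apply: eq_bigr.
Qed.

Lemma pvar_countE : N = (\sum_i b i)%N.
Proof.
rewrite -[LHS]card_ord -sum1_card (sum_pvar (fun _ _ => 1%N)).
by apply: eq_bigr => i _; rewrite sum1_card card_ord.
Qed.

Lemma sum_ord_lt m c : (m <= c)%N -> (\sum_(j < c) (j < m) = m)%N.
Proof.
move=> le_mc; rewrite -[RHS]card_ord -sum1_card (big_ord_widen _ (fun=> 1%N) le_mc).
by rewrite [RHS]big_mkcond; apply: eq_bigr => j _; case: (j < m)%N.
Qed.

(** In group i, V_u consists of the levels below the largest exponent of x_i among the factors,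
    which is the exponent of x_i in the lcm. *)
Lemma card_lowset_lgen k (f : 'I_k -> 'X_{1..n}) : (forall j, A (f j)) ->
  #|lowset pgrp plev (\sum_(j < k) lgen (f j))%MM| = mdeg (\big[@mlcm n/0%MM]_(j < k) f j).
Proof.
move=> Af; set M := (X in _ = mdeg X).
have lowE w : (w \in lowset pgrp plev (\sum_(j < k) lgen (f j))%MM) =
    (plev w < M (pgrp w))%N.
  rewrite inE mlcm_bigE; apply/existsP/idP => [[v /and3P[nz /eqP eq_g lt_wv]]|].
    have [j eq_j] := sum_lgen_neq0 nz; apply: leq_trans lt_wv _.
    by rewrite eq_j eq_g; apply: leq_bigmax.
  rewrite ltnNge => /bigmax_leqP nle; apply: contrapT => no; apply: nle => j _.
  rewrite leqNgt; apply/negP => lt_w; apply: no.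
  exists (pidx (Ordinal (compl_lt (pgrp w) (Af j)))).
  rewrite pgrp_pidx plev_pidx eqxx lt_w !andbT sum_lgen (bigD1 j) //=.
  by rewrite pgrp_pidx plev_pidx eqxx.
rewrite -sum1_card big_mkcond /= mdegE.
rewrite (eq_bigr (fun w => (plev w < M (pgrp w))%N : nat)) => [|w _]; last first.
  by rewrite lowE; case: ltnP.
rewrite (sum_pvar (fun i j => (j < M i)%N : nat)); apply: eq_bigr => i _.
by apply: sum_ord_lt; apply: leq_trans (leq_pred _); apply: lcm_le.
Qed.

Lemma lcm_degree_le k l : lcm_degree I k l -> (l <= \sum_i (b i).-1)%N.
Proof. by case=> f [Af ->]; rewrite mdegE leq_sum // => i _; apply: lcm_le. Qed.

Lemma ex_lcm_degree k : exists M, is_greatest (lcm_degree I k) M.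
Proof.
have ex : exists l, `[< lcm_degree I k l >].
  exists (mdeg (\big[@mlcm n/0%MM]_(j < k) 0%MM)); apply/asboolP.
  by exists (fun=> 0%MM); split=> // j; rewrite /mon_compl mpolyX0.
have bound l : `[< lcm_degree I k l >] -> (l <= \sum_i (b i).-1)%N.
  by move=> /asboolP/lcm_degree_le.
case: (ex_maxnP ex bound) => M /asboolP MP maxM.
by exists M; split=> // l lP; apply: maxM; apply/asboolP.
Qed.

Lemma sum_pred : (\sum_i b i = \sum_i (b i).-1 + n)%N.
Proof.
rewrite -[X in (_ + X)%N]card_ord -sum1_card -big_split; apply: eq_bigr => i _ /=.
by rewrite addn1 prednK ?b_gt0.
Qed.

Lemma L_depth k M d : (0 < k)%N -> is_greatest (lcm_degree I k) M ->
  (d + M.+1 = \sum_i b i)%N -> has_L_depth I b k d.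
Proof.
move=> k_gt0 [[f [Af MP]] maxM] eq_d; rewrite /has_L_depth L_powE.
(* All generators of L(I)^k have degree n k, so they can be listed among the finitely many exponents
   of degree at most n k. *)
pose s := [seq val m | m <- enum {: 'X_{1..N < (n * k).+1}} & `[< lpow_gen k (val m) >]].
have sP g : (g \in s) <-> lpow_gen k g.
  split=> [/mapP[m + ->]|kg]; first by rewrite mem_filter => /andP[/asboolP].
  have lt_g : (mdeg g < (n * k).+1)%N by rewrite (mdeg_multideg (lpow_gen_multideg kg)).
  apply/mapP; exists (BMultinom lt_g) => //.
  by rewrite mem_filter mem_enum andbT; apply/asboolP.
have -> : lpow_gen k = (fun g => g \in s).
  by apply/funext => g; apply/propext; split=> /sP.
have low f' : (forall j, A (f' j)) ->
    (#|lowset pgrp plev (\sum_(j < k) lgen (f' j))%MM| <= M)%N.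
  by move=> Af'; rewrite card_lowset_lgen //; apply: maxM; exists f'.
have low_f := card_lowset_lgen Af; rewrite -MP in low_f.
apply: (stable_depth K pgrp_lev_inj n_gt0 k_gt0 _ _ (u := (\sum_(j < k) lgen (f j))%MM)).
- by move=> u v w /sP ku uv eq_g lt_wv; apply/sP/lpow_gen_stable.
- by move=> g /sP/lpow_gen_multideg.
- by apply/sP; exists f.
- by move=> g /sP[f' [Af' ->]]; rewrite low_f; apply: low.
- by rewrite low_f eq_d pvar_countE.
Qed.

(** The n powers x_i^(b_i - 1), padded with 1 up to length [k], attain the upper bound. *)
Lemma lcm_degree_ge k : (n <= k)%N -> is_greatest (lcm_degree I k) (\sum_i (b i).-1)%N.
Proof.
move=> le_nk; split=> [|l /lcm_degree_le //].
pose f (j : 'I_k) : 'X_{1..n} :=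
  if insub (val j) is Some i then (U_(i) *+ (b i).-1)%MM else 0%MM.
have Af j : A (f j).
  rewrite /f; case: insubP => [i _ _|_]; first exact: compl_pred_power.
  by rewrite /mon_compl mpolyX0.
exists f; split=> //; apply/eqP; rewrite eqn_leq; apply/andP; split; last first.
  by rewrite mdegE leq_sum // => i _; apply: lcm_le.
rewrite mdegE leq_sum // => i _; rewrite mlcm_bigE.
pose j := widen_ord le_nk i; have -> : (b i).-1 = f j i.
  rewrite /f insubT /= => [|lt_in]; first exact: ltn_ord.
  rewrite (_ : Sub _ _ = i); last exact: val_inj.
  by rewrite mulmnE mnm1E eqxx mul1n.
by apply: leq_bigmax.
Qed.

(** If the lcm is not yet maximal in x_i, adjoin x_i^(b_i - 1) as a further factor. *)
Lemma lcm_degree_lt k M M' : is_greatest (lcm_degree I k) M ->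
  is_greatest (lcm_degree I k.+1) M' -> (M < \sum_i (b i).-1)%N -> (M < M')%N.
Proof.
move=> [[f [Af ->]] _] [_ maxM']; set m := \big[_/_]_(_ < _) _; rewrite mdegE => lt_M.
have [i lt_i] : exists i, (m i < (b i).-1)%N.
  apply: contrapT => no; move: lt_M; rewrite ltnNge leq_sum // => i _.
  by rewrite leqNgt; apply/negP => lt_i; apply: no; exists i.
pose a := (U_(i) *+ (b i).-1)%MM.
apply: leq_trans (maxM' (mdeg (mlcm a m)) _); last first.
  exists (fun j => if unlift ord0 j is Some j' then f j' else a); split=> [j|].
    by case: unliftP => [j'|] _ //; apply: compl_pred_power.
  rewrite big_ord_recl unlift_none; congr (mdeg (mlcm _ _)).
  by apply: eq_bigr => j _; rewrite liftK.
rewrite mdegE (bigD1 i) //= [X in (_ < X)%N](bigD1 i) //= -addSn leq_add //.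
  by rewrite mnmE mulmnE mnm1E eqxx mul1n leq_max lt_i.
by apply: leq_sum => j _; rewrite mnmE leq_maxr.
Qed.

End LIdeal.

(** * The depth formula and its consequences *)

Lemma is_greatest_uniq P m m' : is_greatest P m -> is_greatest P m' -> m = m'.
Proof.
by move=> [Pm max] [Pm' max']; apply/eqP; rewrite eqn_leq max ?max'.
Qed.

Theorem corollary4p2 (K : fieldType) (n : nat) (n_gt0 : (0 < n)%N)
    (I : {mpoly K[n]} -> Prop)
    (I_mon : is_monomial_ideal I) (I_dim0 : has_quot_dim I 0) :
  exists b : 'I_n -> nat,
    (forall i, is_least (fun c => I ('X_i ^+ c)) (b i)) /\
    [/\ forall k, (1 <= k)%N ->
          exists d M : nat,
            [/\ has_L_depth I b k d,
                is_greatest (lcm_degree I k) M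
              & d%:Z = (\sum_(i < n) b i)%N%:Z - M%:Z - 1],
        forall k, (n <= k)%N -> has_L_depth I b k n.-1
      & forall k d d', (1 <= k)%N ->
          has_L_depth I b k d -> has_L_depth I b k.+1 d' ->
          (n.-1 < d)%N -> (d' < d)%N].
Proof.
have I_id : is_ideal I.
  have [G IG] := I_mon; rewrite (_ : I = ideal_gen (fun q => exists m, G m /\ q = 'X_[m])).
    exact: ideal_gen_ideal.
  by apply/funext => p; apply/propext.
(* A dimension exists only if some prime contains [I]. *)
have I_proper : ~ I 1.
  have [[P [+ _]] _] := I_dim0 => /(_ 0%N isT)[[_ nP1 _] IP] I1.
  by apply: nP1; apply: IP.
have /choice[b b_least] : forall i, exists c, is_least (fun c => I ('X_i ^+ c)) c.
  move=> i; have [c Ic] := dim0_pure_power i I_mon I_dim0.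
  have exc : exists c, `[< I ('X_i ^+ c) >] by exists c; apply/asboolP.
  case: (ex_minnP exc) => m /asboolP Im minm; exists m; split=> // c' Ic'.
  by apply: minm; apply/asboolP.
have sumb := sum_pred I_proper b_least.
have depth k M : (0 < k)%N -> is_greatest (lcm_degree I k) M ->
    has_L_depth I b k (\sum_i b i - M.+1) /\ (M < \sum_i b i)%N.
  move=> k_gt0 MP; have le_M := lcm_degree_le I_id I_proper b_least MP.1.
  have lt_M : (M < \sum_i b i)%N by rewrite sumb; lia.
  split=> //; apply: (L_depth I_id n_gt0 I_proper b_least k_gt0 MP).
  by rewrite subnK.
have ex_lcm := ex_lcm_degree I_id I_proper b_least.
exists b; split=> //; split=> [k k_gt0|k le_nk|k d d' k_gt0 dP dP' lt_d].
- have [M MP] := ex_lcm k; have [dP lt_M] := depth k M k_gt0 MP.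
  exists (\sum_i b i - M.+1)%N, M; split=> //.
  by move: (\sum_i b i)%N lt_M => S; lia.
- have k_gt0 := leq_trans n_gt0 le_nk.
  have [] := depth k _ k_gt0 (lcm_degree_ge I_id I_proper b_least le_nk).
  by rewrite sumb (_ : (_ - _ = n.-1)%N) //; lia.
have [M MP] := ex_lcm k; have [M' MP'] := ex_lcm k.+1.
have [dM lt_M] := depth k M k_gt0 MP; have [dM' lt_M'] := depth k.+1 M' isT MP'.
have eq_d := is_greatest_uniq dP dM; have eq_d' := is_greatest_uniq dP' dM'.
(* Depth above n - 1 says exactly that the lcm degree has not reached its bound, so it still grows
   with [k]. *)
have lt_sum : (M < \sum_i (b i).-1)%N by lia.
have := lcm_degree_lt I_proper b_least MP MP' lt_sum; lia.
Qed.
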